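(* Let $G=\mathrm{SL}(3,\mathbb{C})$ act on $G\times G$ by simultaneous conjugation. Then the quotient $(G\times G)/\!\!/G$ is isomorphic to a degree $6$ affine hypersurface in $\mathbb{C}^9$, which maps onto $\mathbb{C}^8$.
   Context: $G=\mathrm{SL}(3,\mathbb{C})$ is regarded as an affine algebraic group. It acts on the coordinate ring $\mathbb{C}[G\times G]$ by $(g\cdot f)(\mathbf{x}_1,\mathbf{x}_2)=f(g^{-1}\mathbf{x}_1g,\,g^{-1}\mathbf{x}_2g)$, where $\mathbf{x}_1,\mathbf{x}_2$ are the two generic unimodular $3\times 3$ matrices whose entries are the coordinate functions on the two factors. The ring of invariants $\mathbb{C}[G\times G]^G$ is a finitely generated $\mathbb{C}$-algebra, and $(G\times G)/\!\!/G=\mathrm{Spec}_{max}(\mathbb{C}[G\times G]^G)$ is the affine variety whose coordinate ring is this ring of invariants. *)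

(* Defs.v *)
From HB Require Import structures.
From mathcomp Require Import all_boot all_order all_algebra.
From mathcomp Require Import boolp classical_sets functions reals.
From mathcomp Require Import complex mpoly.

Set Implicit Arguments.
Unset Strict Implicit.
Unset Printing Implicit Defensive.

Import GRing.Theory.
Local Open Scope ring_scope.
Local Open Scope classical_set_scope.

(* An affine variety over an algebraically closed field K is handled as a set
   of points together with its K-valued regular functions.  With this encoding
   a map between affine varieties is a morphism exactly when it pulls regular
   functions back to regular functions. *)
Record variety (K : Type) := Variety {
  point_of :> Type;
  regular : set (point_of -> K)
}.

(* An isomorphism: a bijective morphism whose inverse is also a morphism. *)
Definition isomorphic (K : Type) (V W : variety K) : Prop :=
  exists phi : V -> W,
    bijective phi /\ forall f : W -> K, regular f <-> regular (f \o phi).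

Section AffineSpace.
Variables (K : fieldType) (n : nat).
Implicit Types (F p q : {mpoly K[n]}) (X : set ('I_n -> K)).

(* The variety structure induced on X by K^n; meant for Zariski closed X. *)
Definition affine_subvariety X : variety K :=
  @Variety K X [set f | exists p, forall x : X, f x = p.@[\val x]].

(* X is the zero locus of F, and F generates the ideal of all polynomials
   vanishing on X; hence F is a reduced equation of X, and the degree of X is
   the total degree of F (which is (msize F).-1). *)
Definition hypersurface_of_degree (d : nat) X : Prop :=
  exists F, [/\ msize F = d.+1,
                X = [set x | F.@[x] = 0]
              & forall p, (forall x, X x -> p.@[x] = 0) <->
                          exists q, p = q * F].

End AffineSpace.

Definition forget_last (K : Type) (n : nat) (x : 'I_n.+1 -> K) : 'I_n -> K :=
  fun i => x (widen_ord (leqnSn n) i).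

Section MaximalSpectrum.
Variables (K : fieldType) (A : comAlgType K).

Definition maximal_ideal (m : {pred A}) : Prop :=
  idealr_closed m /\
  forall I : {pred A}, idealr_closed I -> {subset m <= I} -> {subset I <= m}.

Definition max_spectrum := {m : A -> bool | `[< maximal_ideal m >]}.

(* a in A defines the function sending m to the element c of K whose class in
   A / m is that of a, i.e. such that a - c.1 lies in m. *)
Definition Spec_max : variety K :=
  @Variety K max_spectrum
    [set f | exists a : A, forall m : max_spectrum, sval m (a - (f m)%:A)].

End MaximalSpectrum.

(* Functions take values in K^o, i.e. K seen as a module over itself, because
   the pointwise scaling of T -> V by K needs V to be a K-module. *)
Section FunctionAlgebra.
Variables (K : fieldType) (T : pointedType).

Fact fct_scalerAl (a : K) (f g : T -> K^o) : a *: (f * g) = a *: f * g.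
Proof. by apply/funext => t; exact: mulrA. Qed.

Fact fct_scalerAr (a : K) (f g : T -> K^o) : a *: (f * g) = f * (a *: g).
Proof. by apply/funext => t; exact: mulrCA. Qed.

HB.instance Definition _ :=
  GRing.Lmodule_isLalgebra.Build K (T -> K^o) fct_scalerAl.
HB.instance Definition _ :=
  GRing.Lalgebra_isAlgebra.Build K (T -> K^o) fct_scalerAr.

End FunctionAlgebra.

Section SpecialLinear.
Variables (K : fieldType) (n : nat).

Definition SL := {M : 'M[K]_n | \det M == 1}.
HB.instance Definition _ := SubType.on SL.
HB.instance Definition _ := Choice.on SL.

Fact det1_subproof : \det (1%:M : 'M[K]_n) == 1.
Proof. by rewrite det1. Qed.

HB.instance Definition _ := isPointed.Build SL (Sub 1%:M det1_subproof).

Fact conj_subproof (g x : SL) :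
  \det (invmx (\val g) *m \val x *m \val g) == 1.
Proof.
by rewrite !det_mulmx det_inv (eqP (valP g)) (eqP (valP x)) invr1 !mulr1.
Qed.

Definition SL_conj (g x : SL) : SL :=
  Sub (invmx (\val g) *m \val x *m \val g) (conj_subproof g x).

Definition pair_coords (x : SL * SL) : 'I_(n * n + n * n) -> K :=
  row_mx (mxvec (\val x.1)) (mxvec (\val x.2)) ord0.

(* K[SL x SL], realised as regular functions: restrictions of polynomials in
   the entries of the two matrices. *)
Definition coordinate_ring : set (SL * SL -> K^o) :=
  [set f | exists p : {mpoly K[n * n + n * n]},
             forall x, f x = p.@[pair_coords x]].

Definition SL_act (g : SL) (f : SL * SL -> K^o) : SL * SL -> K^o :=
  fun x => f (SL_conj g x.1, SL_conj g x.2).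

Definition is_invariant : {pred SL * SL -> K^o} :=
  fun f => `[< coordinate_ring f /\ forall g : SL, SL_act g f = f >].

Fact is_invariant_subalg : subalg_closed is_invariant.
Proof.
split.
- apply/asboolP; split=> [|g]; last by apply/funext.
  by exists 1 => x; rewrite meval1.
- move=> a u v /asboolP[[p up] uI] /asboolP[[q vq] vI].
  apply/asboolP; split=> [|g].
    exists (a *: p + q) => x.
    by rewrite mevalD mevalZ -up -vq.
  by rewrite -{2}(uI g) -{2}(vI g).
- move=> u v /asboolP[[p up] uI] /asboolP[[q vq] vI].
  apply/asboolP; split=> [|g].
    by exists (p * q) => x; rewrite mevalM -up -vq.
  by rewrite -{2}(uI g) -{2}(vI g).
Qed.

HB.instance Definition _ :=
  GRing.isSubalgClosed.Build K (SL * SL -> K^o) is_invariant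
    is_invariant_subalg.

Definition invariant_ring := {f : SL * SL -> K^o | f \in is_invariant}.
HB.instance Definition _ := SubType.on invariant_ring.
HB.instance Definition _ := Choice.on invariant_ring.
HB.instance Definition _ :=
  [SubChoice_isSubAlgebra of invariant_ring by <:].
HB.instance Definition _ :=
  [SubNzRing_isSubComNzRing of invariant_ring by <:].

Definition conj_quotient : variety K := Spec_max invariant_ring.

End SpecialLinear.

(* Main.v *)
Require Import Defs.
From mathcomp Require Import all_boot all_order all_algebra.
From mathcomp Require Import boolp classical_sets functions reals.
From mathcomp Require Import complex mpoly.
From mathcomp Require Import perm ring lra zify.

Set Implicit Arguments.
Unset Strict Implicit.
Unset Printing Implicit Defensive.

Import Order.TTheory GRing.Theory Num.Theory.
Local Open Scope ring_scope.

(* The invariants are generated by the traces t1, ..., t8 of A, B, AB, AB^-1 and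
   of their inverses, together with the trace t9 of the commutator, which is a
   root of a monic quadratic F over C[t1, ..., t8]; the other root is the trace
   of the inverse commutator.

   If A has distinct eigenvalues we may take A = diag(a1, a2, a3).  A function
   of B invariant under conjugation by diagonal matrices is a polynomial in the
   B_ii, the B_ij B_ji and the two products along 3-cycles, and each of these
   becomes a polynomial in a1, a2, a3 and the traces after multiplication by a
   power of the Vandermonde determinant of a.  Symmetrizing over the orderings
   of a gives disc(A)^k f = H(t1, ..., t9) for every invariant f, and exchanging
   the roles of A and B gives disc(B)^k f = H'(t1, ..., t9).  Both identities
   can be read in C[t1, ..., t9]/(F), which is free over C[t1, ..., t8] with
   basis 1, t9; as disc(A) and disc(B) involve disjoint sets of variables, the
   denominators cancel and f is a polynomial in t1, ..., t9.

   On the slice A = diag(a1, a2, a3) one also sees that F(t) = 0 and that every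
   zero of F with disc(A) <> 0 is attained, so that (F) is the ideal of all
   relations.  Finally the residue fields of the ring of invariants are C,
   because this ring has countable dimension and C is uncountable. *)

(** * Multivariate polynomials *)

Lemma mpoly_generators_ind (K : comNzRingType) n (Q : {mpoly K[n]} -> Prop) :
    (forall c, Q c%:MP) -> (forall i, Q 'X_i) ->
    (forall p q, Q p -> Q q -> Q (p + q)) ->
    (forall p q, Q p -> Q q -> Q (p * q)) -> forall p, Q p.
Proof.
move=> QC QX QD QM; elim/mpolyind => [|c m p _ _ IH]; first exact: (QC 0).
apply: (QD) => //; rewrite -mul_mpolyC; apply: (QM) => //.
rewrite mpolyXE_id; elim: (index_enum _) => [|i r IHr].
  by rewrite big_nil; exact: (QC 1).
rewrite big_cons; apply: (QM) => //.
by elim: (m i) => [|k IHk]; [exact: (QC 1)|rewrite exprS; exact: (QM)].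
Qed.

(** Serves regularity, rationality along a curve and expansion into monomials alike: a property
    stable under ring operations passes from the coordinates to every polynomial in them. *)
Lemma meval_closed (T : Type) (K : comNzRingType) n (Q : (T -> K) -> Prop)
    (v : T -> 'I_n -> K) (p : {mpoly K[n]}) :
    (forall c, Q (fun=> c)) ->
    (forall f g, Q f -> Q g -> Q (fun t => f t + g t)) ->
    (forall f g, Q f -> Q g -> Q (fun t => f t * g t)) ->
    (forall i, Q (fun t => v t i)) -> Q (fun t => p.@[v t]).
Proof.
move=> QC QD QM Qv; elim/mpoly_generators_ind: p => [c|i|p q Qp Qq|p q Qp Qq].
- by under eq_fun do rewrite mevalC.
- by under eq_fun do rewrite mevalXU.
- by under eq_fun do rewrite mevalD; exact: QD.
- by under eq_fun do rewrite mevalM; exact: QM.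
Qed.

Section LastVariable.
Variables (K : comNzRingType) (n : nat).
Implicit Types (p : {mpoly K[n.+1]}) (q : {poly {mpoly K[n]}}).

(** Undoes [muni], which regards a polynomial as univariate in its last variable, so that results of
    univariate division can be carried back. *)
Definition of_muni q : {mpoly K[n.+1]} := (map_poly (@mwiden n K)
  q).['X_ord_max].

Lemma of_muniD : {morph of_muni : p q / p + q}.
Proof. by move=> p q; rewrite /of_muni rmorphD hornerD. Qed.

Lemma of_muniM : {morph of_muni : p q / p * q}.
Proof. by move=> p q; rewrite /of_muni rmorphM hornerM. Qed.

Lemma of_muniC c : of_muni c%:P = mwiden c.
Proof. by rewrite /of_muni map_polyC hornerC. Qed.

Lemma of_muniX : of_muni 'X = 'X_ord_max.
Proof. by rewrite /of_muni map_polyX hornerX. Qed.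

Lemma muniX_widen (i : 'I_n) :
  muni 'X_(widen_ord (leqnSn n) i) = ('X_i : {mpoly K[n]})%:P.
Proof.
rewrite muniE msuppX big_seq1 mcoeffX eqxx scale1r mnmE.
have /negbTE -> : widen_ord (leqnSn n) i != ord_max.
  by rewrite -val_eqE /= ltn_eqF.
rewrite expr0 alg_polyC; congr (_%:P); congr 'X_[_].
by apply/mnmP => j; rewrite !mnmE -!val_eqE.
Qed.

Lemma muniX_max : muni 'X_ord_max = 'X :> {poly {mpoly K[n]}}.
Proof.
rewrite muniE msuppX big_seq1 mcoeffX eqxx scale1r mnmE eqxx expr1.
rewrite (_ : [multinom _ | _ < n] = 0%MM) ?mpolyX0 ?scale1r //.
by apply/mnmP => j; rewrite !mnmE -val_eqE /= gtn_eqF.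
Qed.

Lemma muniK p : of_muni (muni p) = p.
Proof.
elim/mpoly_generators_ind: p => [c|i|p q IHp IHq|p q IHp IHq].
- by rewrite muniC of_muniC mwidenC.
- case: (unliftP ord_max i) => [j|] ->; last by rewrite muniX_max of_muniX.
  have -> : lift ord_max j = widen_ord (leqnSn n) j.
    by apply/val_inj; rewrite /= /bump leqNgt ltn_ord.
  by rewrite muniX_widen of_muniC mwidenX mnmwiden1.
- by rewrite muniD of_muniD; exact: f_equal2 IHp IHq.
- by rewrite muniM of_muniM; exact: f_equal2 IHp IHq.
Qed.

Lemma meval_mwiden (p : {mpoly K[n]}) v :
  (mwiden p).@[v] = p.@[v \o widen_ord (leqnSn n)].
Proof.
elim/mpolyind: p => [|c m p _ _ IH]; first by rewrite mwiden0 !meval0.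
rewrite mwidenD !mevalD IH mwidenZ !mevalZ mwidenX !mevalX; congr (_ * _ + _).
rewrite big_ord_recr /= mnmwiden_ordmax expr0 mulr1.
by apply: eq_bigr => i _; rewrite mnmwiden_widen.
Qed.

Lemma meval_of_muni q v :
  (of_muni q).@[v] =
  (map_poly (meval (v \o widen_ord (leqnSn n))) q).[v ord_max].
Proof.
elim/poly_ind: q => [|q c IH].
  by rewrite /of_muni !rmorph0 !horner0 meval0.
rewrite of_muniD of_muniM of_muniC of_muniX mevalD mevalM mevalXU IH.
by rewrite meval_mwiden rmorphD rmorphM /= map_polyX map_polyC hornerMXaddC.
Qed.

Lemma meval_muni p v :
  p.@[v] = (map_poly (meval (v \o widen_ord (leqnSn n))) (muni p)).[v ord_max].
Proof. by rewrite -meval_of_muni muniK. Qed.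

End LastVariable.

Definition rcons_ord (K : Type) n (v : 'I_n -> K) (y : K) (i : 'I_n.+1) : K :=
  if unlift ord_max i is Some j then v j else y.

Lemma rcons_ord_max (K : Type) n (v : 'I_n -> K) (y : K) :
  rcons_ord v y ord_max = y.
Proof. by rewrite /rcons_ord unlift_none. Qed.

Lemma rcons_ord_widen (K : Type) n (v : 'I_n -> K) (y : K) i :
  rcons_ord v y (widen_ord (leqnSn n) i) = v i.
Proof.
rewrite /rcons_ord (_ : widen_ord _ i = lift ord_max i) ?liftK //.
by apply/val_inj; rewrite /= /bump leqNgt ltn_ord.
Qed.

(** The first [size p] natural numbers are distinct in [K], which is more roots than a nonzero [p]
    can have. *)
Lemma poly_eq0_horner (K : numDomainType) (p : {poly K}) :
  (forall x, p.[x] = 0) -> p = 0.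
Proof.
move=> p0; apply/eqP/negPn/negP => pn0.
pose rs := [seq i%:R : K | i <- iota 0 (size p)].
have : (size rs < size p)%N.
  apply: max_poly_roots pn0 _ _; first by apply/allP => x _; apply/rootP.
  by rewrite map_inj_uniq ?iota_uniq //; move=> i j /eqP;
    rewrite eqr_nat => /eqP.
by rewrite size_map size_iota ltnn.
Qed.

(** Induction on the number of variables: with the first ones fixed at [v], the polynomial in the
    last one vanishes identically, so each of its coefficients vanishes at [v]. *)
Lemma mpoly_eq0_meval (K : numDomainType) n (p : {mpoly K[n]}) :
  (forall v, p.@[v] = 0) -> p = 0.
Proof.
elim: n p => [|n IH] p p0.
  have pC : p = (p@_0)%:MP.
    apply/mpolyP => m; have -> : m = 0%MM by apply/mnmP => -[].
    by rewrite mcoeffC eqxx mulr1.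
  by have := p0 (fun=> 0); rewrite pC mevalC => ->; rewrite mpolyC0.
suff p'0 : muni p = 0 by rewrite -(muniK p) p'0 /of_muni rmorph0 horner0.
apply/polyP => i; rewrite coef0; apply: IH => v.
have : map_poly (meval v) (muni p) = 0.
  apply: poly_eq0_horner => y; have := p0 (rcons_ord v y).
  rewrite meval_muni rcons_ord_max.
  by rewrite (_ : _ \o _ = v) //; apply/funext => j /=; rewrite rcons_ord_widen.
by move/polyP/(_ i); rewrite coef_map coef0.
Qed.

(** * The relation between the nine traces *)

Section Relation.
Variable K : comNzRingType.

(* With y0, ..., y7 the traces of A^-1, B, B^-1, AB, A^-1 B^-1, A B^-1, A^-1 B
   and A, these are the sum and the product of the traces of the commutator
   A B A^-1 B^-1 and of its inverse. *)
Definition rel_sum (y : nat -> K) : K :=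
  y 0 * y 1 * y 2 * y 7 - y 0 * y 1 * y 5 - y 0 * y 2 * y 3 - y 1 * y 4 * y 7
  - y 2 * y 6 * y 7 + y 0 * y 7 + y 1 * y 2 + y 3 * y 4 + y 5 * y 6 - 3.

Definition rel_prod (y : nat -> K) : K :=
  y 0 ^+ 2 * y 1 * y 2 * y 7 ^+ 2 + y 0 * y 1 ^+ 2 * y 2 ^+ 2 * y 7
  - y 0 ^+ 3 * y 1 * y 2 + y 0 ^+ 2 * y 1 ^+ 2 * y 6
  - y 0 ^+ 2 * y 1 * y 5 * y 7 + y 0 ^+ 2 * y 2 ^+ 2 * y 4
  - y 0 ^+ 2 * y 2 * y 3 * y 7 - y 0 * y 1 ^+ 3 * y 7
  - y 0 * y 1 ^+ 2 * y 2 * y 5 - y 0 * y 1 * y 2 ^+ 2 * y 3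
  - y 0 * y 1 * y 2 * y 4 * y 6 - y 0 * y 1 * y 3 * y 6 * y 7
  - y 0 * y 1 * y 4 * y 7 ^+ 2 - y 0 * y 2 ^+ 3 * y 7
  - y 0 * y 2 * y 4 * y 5 * y 7 - y 0 * y 2 * y 6 * y 7 ^+ 2
  - y 1 ^+ 2 * y 2 * y 4 * y 7 + y 1 ^+ 2 * y 3 * y 7 ^+ 2
  - y 1 * y 2 ^+ 2 * y 6 * y 7 - y 1 * y 2 * y 3 * y 5 * y 7
  - y 1 * y 2 * y 7 ^+ 3 + y 2 ^+ 2 * y 5 * y 7 ^+ 2 + y 0 ^+ 2 * y 1 * y 4
  + y 0 ^+ 2 * y 2 * y 6 + y 0 ^+ 2 * y 3 * y 5 + y 0 * y 1 ^+ 2 * y 3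
  + y 0 * y 1 * y 2 * y 7 - 2 * y 0 * y 1 * y 6 ^+ 2 + y 0 * y 2 ^+ 2 * y 5
  - 2 * y 0 * y 2 * y 4 ^+ 2 + y 0 * y 3 ^+ 2 * y 6 + y 0 * y 3 * y 4 * y 7
  + y 0 * y 4 * y 5 ^+ 2 + y 0 * y 5 * y 6 * y 7 + y 1 ^+ 2 * y 4 * y 5
  + y 1 ^+ 2 * y 6 * y 7 + y 1 * y 2 * y 3 * y 4 + y 1 * y 2 * y 5 * y 6
  - 2 * y 1 * y 3 ^+ 2 * y 7 + y 1 * y 3 * y 5 ^+ 2 + y 1 * y 4 ^+ 2 * y 6
  + y 1 * y 5 * y 7 ^+ 2 + y 2 ^+ 2 * y 3 * y 6 + y 2 ^+ 2 * y 4 * y 7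
  + y 2 * y 3 ^+ 2 * y 5 + y 2 * y 3 * y 7 ^+ 2 + y 2 * y 4 * y 6 ^+ 2
  - 2 * y 2 * y 5 ^+ 2 * y 7 + y 3 * y 4 * y 5 * y 6 + y 3 * y 6 ^+ 2 * y 7
  + y 4 ^+ 2 * y 5 * y 7 + y 4 * y 6 * y 7 ^+ 2 + y 0 ^+ 3
  + 3 * y 0 * y 1 * y 5 + 3 * y 0 * y 2 * y 3 - 3 * y 0 * y 4 * y 6
  + y 1 ^+ 3 - 3 * y 1 * y 3 * y 6 + 3 * y 1 * y 4 * y 7 + y 2 ^+ 3
  - 3 * y 2 * y 4 * y 5 + 3 * y 2 * y 6 * y 7 + y 3 ^+ 3
  - 3 * y 3 * y 5 * y 7 + y 4 ^+ 3 + y 5 ^+ 3 + y 6 ^+ 3 + y 7 ^+ 3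
  - 6 * y 0 * y 7 - 6 * y 1 * y 2 - 6 * y 3 * y 4 - 6 * y 5 * y 6 + 9.

End Relation.

(* Here a_i, b_i and m_i stand for the diagonal entries of A = diag(a1, a2, a3),
   B and B^-1; by the hypothesis the inverse of a1 is a2 * a3, and so on. *)
Section Slice.
Variable K : comNzRingType.
Variables a1 a2 a3 b1 b2 b3 m1 m2 m3 : K.
Hypothesis a123 : a1 * a2 * a3 = 1.

Definition slice_traces : nat -> K := nth 0
  [:: a2 * a3 + a1 * a3 + a1 * a2; b1 + b2 + b3; m1 + m2 + m3;
      a1 * b1 + a2 * b2 + a3 * b3;
      a2 * a3 * m1 + a1 * a3 * m2 + a1 * a2 * m3;
      a1 * m1 + a2 * m2 + a3 * m3;
      a2 * a3 * b1 + a1 * a3 * b2 + a1 * a2 * b3;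
      a1 + a2 + a3].

(* The value forced on B12 B23 B31 + B13 B21 B32 by det B = 1. *)
Definition slice_s : K :=
  1 + 2 * b1 * b2 * b3 - b1 * m1 - b2 * m2 - b3 * m3.

(* a1/a2 + a2/a3 + a3/a1 *)
Definition slice_rho : K := a1 ^+ 2 * a3 + a2 ^+ 2 * a1 + a3 ^+ 2 * a2.
Definition slice_rho' : K := a2 ^+ 2 * a3 + a3 ^+ 2 * a1 + a1 ^+ 2 * a2.

(** The part of the commutator trace free of the two 3-cycle products of [B]; each [b_i * b_j - m_k]
    stands for [B_ij * B_ji]. *)
Definition slice_C : K :=
  b1 * m1 + b2 * m2 + b3 * m3
  - (a1 ^+ 2 * a3 + a2 ^+ 2 * a3) * (b1 * b2 - m3) * b3
  - (a2 ^+ 2 * a1 + a3 ^+ 2 * a1) * (b2 * b3 - m1) * b1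
  - (a3 ^+ 2 * a2 + a1 ^+ 2 * a2) * (b1 * b3 - m2) * b2.

(** With [al] and [be] the 3-cycle products and [s = al + be], this is the sum of
    [C + al * rho + be * rho'] and [C + al * rho' + be * rho]. *)
Lemma rel_sum_slice :
  rel_sum slice_traces = 2 * slice_C + slice_s * (slice_rho + slice_rho').
Proof.
rewrite /rel_sum /slice_traces /= /slice_s /slice_rho /slice_rho' /slice_C.
ring: a123.
Qed.

(** The product of the same two numbers, with [al * be] replaced by the product of the three
    [B_ij * B_ji]. *)
Lemma rel_prod_slice :
  rel_prod slice_traces =
    slice_C ^+ 2 + slice_C * slice_s * (slice_rho + slice_rho')
    + slice_s ^+ 2 * slice_rho * slice_rho'
    + (b2 * b3 - m1) * (b1 * b3 - m2) * (b1 * b2 - m3)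
      * (slice_rho - slice_rho') ^+ 2.
Proof.
rewrite /rel_prod /slice_traces /= /slice_s /slice_rho /slice_rho' /slice_C.
ring: a123.
Qed.

End Slice.

(** * Determinant, inverse and trace of 3 by 3 matrices *)

Section Matrix3.
Variable K : comUnitRingType.
Implicit Types A B : 'M[K]_3.

Lemma ord3P (P : 'I_3 -> Prop) : P 0 -> P 1 -> P 2 -> forall i, P i.
Proof.
move=> P0 P1 P2 [[|[|[|//]]] lt_i].
- by rewrite (_ : Ordinal lt_i = 0) //; apply/val_inj.
- by rewrite (_ : Ordinal lt_i = 1) //; apply/val_inj.
- by rewrite (_ : Ordinal lt_i = 2) //; apply/val_inj.
Qed.

Lemma big_ord3 (R : Type) (idx : R) (op : Monoid.law idx) (F : 'I_3 -> R) :
  \big[op/idx]_(i < 3) F i = op (op (F 0) (F 1)) (F 2).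
Proof.
rewrite !big_ord_recl big_ord0 Monoid.mulm1 Monoid.mulmA.
by congr (op (op _ (F _)) (F _)); apply/val_inj.
Qed.

Lemma mxtrace3 A : \tr A = A 0 0 + A 1 1 + A 2 2.
Proof. by rewrite /mxtrace big_ord3. Qed.

Lemma mulmx3 A B i j :
  (A *m B) i j = A i 0 * B 0 j + A i 1 * B 1 j + A i 2 * B 2 j.
Proof. by rewrite mxE big_ord3. Qed.

Lemma mulmx3_trace A B : \tr (A *m B) =
  A 0 0 * B 0 0 + A 0 1 * B 1 0 + A 0 2 * B 2 0
  + (A 1 0 * B 0 1 + A 1 1 * B 1 1 + A 1 2 * B 2 1)
  + (A 2 0 * B 0 2 + A 2 1 * B 1 2 + A 2 2 * B 2 2).
Proof. by rewrite mxtrace3 !mulmx3. Qed.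

(** The adjugate; since indices are taken modulo 3, the cyclic minors already carry the cofactor
    signs. *)
Definition adj3 A : 'M[K]_3 := \matrix_(i, j)
  (A (j + 1) (i + 1) * A (j + 2) (i + 2) - A (j + 1) (i + 2) * A (j + 2) (i +
    1)).

Fact ord3_11 : 1 + 1 = 2 :> 'I_3. Proof. exact/val_inj. Qed.
Fact ord3_12 : 1 + 2 = 0 :> 'I_3. Proof. exact/val_inj. Qed.
Fact ord3_21 : 2 + 1 = 0 :> 'I_3. Proof. exact/val_inj. Qed.
Fact ord3_22 : 2 + 2 = 1 :> 'I_3. Proof. exact/val_inj. Qed.

Definition adj3E := (mxE, @add0r 'I_3, ord3_11, ord3_12, ord3_21, ord3_22).

Lemma det3 A : \det A =
  A 0 0 * A 1 1 * A 2 2 + A 0 1 * A 1 2 * A 2 0 + A 0 2 * A 1 0 * A 2 1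
  - A 0 0 * A 1 2 * A 2 1 - A 1 1 * A 0 2 * A 2 0 - A 2 2 * A 0 1 * A 1 0.
Proof.
have det2 (M : 'M[K]_2) : \det M = M 0 0 * M 1 1 - M 0 1 * M 1 0.
  rewrite (expand_det_row _ 0) !big_ord_recl big_ord0 addr0 /cofactor.
  rewrite !det_mx11 !mxE /= expr0 mul1r expr1 mulN1r mulrN.
  by congr (_ * M _ _ - M _ _ * M _ _); apply/val_inj.
rewrite (expand_det_row _ 0) big_ord3 /cofactor !det2 !mxE.
have l00 : lift (0 : 'I_3) (0 : 'I_2) = 1 by exact/val_inj.
have l01 : lift (0 : 'I_3) (1 : 'I_2) = 2 by exact/val_inj.
have l10 : lift (1 : 'I_3) (0 : 'I_2) = 0 by exact/val_inj.
have l11 : lift (1 : 'I_3) (1 : 'I_2) = 2 by exact/val_inj.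
have l20 : lift (2 : 'I_3) (0 : 'I_2) = 0 by exact/val_inj.
have l21 : lift (2 : 'I_3) (1 : 'I_2) = 1 by exact/val_inj.
rewrite !(l00, l01, l10, l11, l20, l21) /= expr0 expr1 expr2; ring.
Qed.

Lemma invmx3 A : \det A = 1 -> invmx A = adj3 A.
Proof.
move=> detA; suff AA : A *m adj3 A = 1%:M.
  have uA : A \in unitmx by rewrite unitmxE detA unitr1.
  by rewrite -[LHS]mulmx1 -AA mulKmx.
have {}detA := esym detA; rewrite det3 in detA.
apply/matrixP => i j; rewrite mulmx3.
elim/ord3P: i; elim/ord3P: j; rewrite !adj3E /= ?mulr1n ?mulr0n ?detA; ring.
Qed.

End Matrix3.

(** * The nine traces on the diagonal slice *)

Section Traces.
Variable K : comUnitRingType.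
Implicit Types A B : 'M[K]_3.

(** The order matters: the commutator comes last, as the coordinate to be forgotten, and the trace
    of [A] just before it, as the main variable in which the two discriminants are compared. *)
Definition pair_traces A B : nat -> K := nth 0
  [:: \tr (invmx A); \tr B; \tr (invmx B);
      \tr (A *m B); \tr (invmx A *m invmx B);
      \tr (A *m invmx B); \tr (invmx A *m B); \tr A;
      \tr (A *m B *m (invmx A *m invmx B))].

Section DiagonalSlice.
Variables (a : 'rV[K]_3) (B : 'M[K]_3).
Hypotheses (a1 : a 0 0 * a 0 1 * a 0 2 = 1) (B1 : \det B = 1).
Let A := diag_mx a.
Let C := invmx B.
Let al := B 0 1 * B 1 2 * B 2 0.
Let be := B 0 2 * B 1 0 * B 2 1.

Lemma pair_traces_slice i : (i < 8)%N -> pair_traces A B i =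
  slice_traces (a 0 0) (a 0 1) (a 0 2) (B 0 0) (B 1 1) (B 2 2)
    (C 0 0) (C 1 1) (C 2 2) i.
Proof.
have detA : \det A = 1 by rewrite det_diag big_ord3.
rewrite /C /pair_traces (invmx3 detA) (invmx3 B1).
case: i => [|[|[|[|[|[|[|[|//]]]]]]]] _;
  rewrite /slice_traces /= ?mulmx3_trace ?mxtrace3;
  rewrite /A ?adj3E /= ?mulr1n ?mulr0n; ring.
Qed.

Lemma slice_diag_inv :
  [/\ C 0 0 = B 1 1 * B 2 2 - B 1 2 * B 2 1,
      C 1 1 = B 0 0 * B 2 2 - B 0 2 * B 2 0
    & C 2 2 = B 0 0 * B 1 1 - B 0 1 * B 1 0].
Proof. by rewrite /C (invmx3 B1) !adj3E; split; ring. Qed.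

Lemma slice_cycle_sum : al + be =
  slice_s (B 0 0) (B 1 1) (B 2 2) (C 0 0) (C 1 1) (C 2 2).
Proof.
have [-> -> ->] := slice_diag_inv; rewrite /slice_s /al /be.
by rewrite -[X in _ = X + _ - _ - _ - _]B1 det3; ring.
Qed.

(** The six off-diagonal entries of [B] can be grouped into two 3-cycles or into three pairs
    [B_ij * B_ji]. *)
Lemma slice_cycle_prod : al * be = (B 1 1 * B 2 2 - C 0 0) *
  (B 0 0 * B 2 2 - C 1 1) * (B 0 0 * B 1 1 - C 2 2).
Proof. by have [-> -> ->] := slice_diag_inv; rewrite /al /be; ring. Qed.

Lemma pair_traces_slice8 : pair_traces A B 8 =
  slice_C (a 0 0) (a 0 1) (a 0 2) (B 0 0) (B 1 1) (B 2 2)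
    (C 0 0) (C 1 1) (C 2 2)
  + al * slice_rho (a 0 0) (a 0 1) (a 0 2)
  + be * slice_rho' (a 0 0) (a 0 1) (a 0 2).
Proof.
have [-> -> ->] := slice_diag_inv.
have detA : \det A = 1 by rewrite det_diag big_ord3.
rewrite /pair_traces (invmx3 detA) (invmx3 B1) /= mxtrace3 !mulmx3.
rewrite /A !adj3E /= ?mulr1n ?mulr0n /slice_C /slice_rho /slice_rho' /al /be.
ring: a1.
Qed.

End DiagonalSlice.
End Traces.

(** * Discriminants, and pairs with prescribed traces *)

Definition disc3 (K : comNzRingType) (e1 e2 : K) : K :=
  e1 ^+ 2 * e2 ^+ 2 - 4 * e1 ^+ 3 - 4 * e2 ^+ 3 + 18 * e1 * e2 - 27.

Definition vdm3 (K : comNzRingType) (a1 a2 a3 : K) : K :=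
  (a1 - a2) * (a2 - a3) * (a3 - a1).

(** [disc3 e1 e2] is the discriminant of [X^3 - e1 X^2 + e2 X - 1], the monic cubic with roots [a1],
    [a2], [a3]. *)
Lemma vdm3_sqr (K : comNzRingType) (a1 a2 a3 : K) : a1 * a2 * a3 = 1 ->
  vdm3 a1 a2 a3 ^+ 2 = disc3 (a1 + a2 + a3) (a2 * a3 + a1 * a3 + a1 * a2).
Proof. by move=> a123; rewrite /vdm3 /disc3; ring: a123. Qed.

(** For distinct eigenvalues the values of [al + be] and [al * rho + be * rho'] therefore determine
    [al] and [be]. *)
Lemma slice_rhoB (K : comNzRingType) (a1 a2 a3 : K) :
  slice_rho a1 a2 a3 - slice_rho' a1 a2 a3 = vdm3 a1 a2 a3.
Proof. by rewrite /vdm3 /slice_rho /slice_rho'; ring. Qed.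

Lemma cubic_roots (K : closedFieldType) (e1 e2 : K) : exists a1 a2 a3,
  [/\ a1 + a2 + a3 = e1, a2 * a3 + a1 * a3 + a1 * a2 = e2 & a1 * a2 * a3 = 1].
Proof.
pose p : {poly K} := 'X^3 - e1 *: 'X^2 + e2 *: 'X - 1.
have sp : size p = 4.
  rewrite /p -addrA -addrA size_polyDl size_polyXn //.
  rewrite (leq_ltn_trans (size_polyD _ _)) // gtn_max size_polyN.
  rewrite (leq_ltn_trans (size_scale_leq _ _)) ?size_polyXn //=.
  rewrite (leq_ltn_trans (size_polyD _ _)) // gtn_max size_polyN size_poly1.
  by rewrite (leq_ltn_trans (size_scale_leq _ _)) ?size_polyX.
have coefp i : p`_i =
    (i == 3)%:R - e1 * (i == 2)%:R + e2 * (i == 1)%:R - (i == 0)%:R.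
  by rewrite /p !coefE.
have [rs pE] := closed_field_poly_normal p.
have lp : lead_coef p = 1 by rewrite /lead_coef sp coefp /=; ring.
rewrite lp scale1r in pE; have := sp; rewrite pE size_prod_XsubC => -[].
case: rs pE => [|a1 [|a2 [|a3 [|//]]]] // pE _; exists a1, a2, a3.
rewrite !big_cons big_nil mulr1 in pE.
have coefp' i : p`_i =
  (('X - a1%:P) * (('X - a2%:P) * ('X - a3%:P)))`_i by rewrite -pE.
have {}pE : ('X - a1%:P) * (('X - a2%:P) * ('X - a3%:P)) =
  'X^3 - (a1 + a2 + a3) *: 'X^2 + (a2 * a3 + a1 * a3 + a1 * a2) *: 'X
  - (a1 * a2 * a3)%:P.
  by rewrite -!mul_polyC !rmorphD !rmorphM /=; ring.
split.
- by have := coefp' 2; rewrite pE coefp !coefE /= => h; apply: oppr_inj;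
    move: h; rewrite !(mulr0, mulr1, subr0, addr0, sub0r).
- by have := coefp' 1;
    rewrite pE coefp !coefE /= !(mulr0, mulr1, subr0, addr0, sub0r, oppr0,
      add0r).
- by have := coefp' 0;
    rewrite pE coefp !coefE /= !(mulr0, mulr1, subr0, addr0, sub0r, oppr0,
      add0r) => /oppr_inj.
Qed.

(* The first row of the inverse of the matrix with rows [1 1 1], [a1 a2 a3] and
   [a2a3 a1a3 a1a2], multiplied by vdm3 a1 a2 a3; the other rows are obtained by
   permuting a1, a2, a3 cyclically. *)
Definition lagrange3 (K : comNzRingType) (a1 a2 a3 z0 z1 z2 : K) : K :=
  a1 * (a2 ^+ 2 - a3 ^+ 2) * z0 + a1 * (a3 - a2) * z1 + (a3 - a2) * z2.

Lemma lagrange3P (K : comNzRingType) (a1 a2 a3 b1 b2 b3 : K) :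
  a1 * a2 * a3 = 1 ->
  lagrange3 a1 a2 a3 (b1 + b2 + b3) (a1 * b1 + a2 * b2 + a3 * b3)
    (a2 * a3 * b1 + a1 * a3 * b2 + a1 * a2 * b3) = vdm3 a1 a2 a3 * b1.
Proof. by move=> a123; rewrite /lagrange3 /vdm3; ring: a123. Qed.

Lemma lagrange3_sol (K : fieldType) (a1 a2 a3 z0 z1 z2 : K) :
  a1 * a2 * a3 = 1 -> vdm3 a1 a2 a3 != 0 -> exists b1 b2 b3,
  [/\ b1 + b2 + b3 = z0, a1 * b1 + a2 * b2 + a3 * b3 = z1
    & a2 * a3 * b1 + a1 * a3 * b2 + a1 * a2 * b3 = z2].
Proof.
move=> a123 V0; exists (lagrange3 a1 a2 a3 z0 z1 z2 / vdm3 a1 a2 a3).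
exists (lagrange3 a2 a3 a1 z0 z1 z2 / vdm3 a1 a2 a3).
exists (lagrange3 a3 a1 a2 z0 z1 z2 / vdm3 a1 a2 a3).
split; rewrite ?mulrA -!mulrDl; apply: (mulIf V0); rewrite divfK //;
  rewrite /lagrange3 /vdm3; ring: a123.
Qed.

(** If [al] is nonzero one can normalise [b12 = b23 = 1], and if [be] is nonzero, [b21 = b32 = 1].
    If both vanish, so does one of [u], [v], [w], and suitable entries are set to zero. *)
Lemma cycle_weights (K : fieldType) (u v w al be : K) : al * be = u * v * w ->
  exists b12 b13 b21 b23 b31 b32,
    [/\ b23 * b32 = u, b13 * b31 = v, b12 * b21 = w,
        b12 * b23 * b31 = al & b13 * b21 * b32 = be].
Proof.
move=> uvw.
have [al0|al_neq0] := eqVneq al 0; last first.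
  exists 1, (v / al), w, 1, al, u; split; rewrite ?mul1r ?divfK //.
  by rewrite -(mulKf al_neq0 be) uvw; ring.
rewrite al0 mul0r in uvw.
have [be0|be_neq0] := eqVneq be 0; last first.
  exists w, be, 1, u, (v / be), 1; split; rewrite ?mulr1 //.
    by rewrite mulrC divfK.
  by rewrite al0 -(mul0r be^-1) uvw; ring.
move/esym/eqP: uvw; rewrite !mulf_eq0 al0 be0 => /orP[/orP[]|] /eqP ->.
- by exists 1, 1, w, 0, v, 0; split; ring.
- by exists 1, 0, w, 1, 0, u; split; ring.
- by exists 0, 1, 0, 1, v, u; split; ring.
Qed.

Definition pair_point (K : comUnitRingType) (A B : 'M[K]_3) : 'I_9 -> K :=
  fun i => pair_traces A B i.

(* The diagonal entries of B and B^-1 are solutions of linear systems, and they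
   determine the products B_ij B_ji; the last trace then determines the products
   of the entries of B along the two 3-cycles, and the relation says that these
   are compatible with the B_ij B_ji. *)
Lemma traces_surj (K : closedFieldType) (y : nat -> K) :
    disc3 (y 7) (y 0) != 0 ->
    y 8 ^+ 2 - rel_sum y * y 8 + rel_prod y = 0 ->
  exists A B : 'M[K]_3, [/\ \det A = 1, \det B = 1 &
    forall i, (i < 9)%N -> pair_traces A B i = y i].
Proof.
move=> D0 rel; have [a1 [a2 [a3 [y7 y0 a123]]]] := cubic_roots (y 7) (y 0).
rewrite -y7 -y0 -vdm3_sqr // expf_eq0 /= in D0.
have [b1 [b2 [b3 [y1 y3 y6]]]] := lagrange3_sol (y 1) (y 3) (y 6) a123 D0.
have [m1 [m2 [m3 [y2 y5 y4]]]] := lagrange3_sol (y 2) (y 5) (y 4) a123 D0.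
pose t := slice_traces a1 a2 a3 b1 b2 b3 m1 m2 m3.
have ty i : (i < 8)%N -> t i = y i.
  by case: i => [|[|[|[|[|[|[|[|//]]]]]]]] _ /=; rewrite /t /slice_traces /=.
have relsum : rel_sum y = rel_sum t by rewrite /rel_sum !ty.
have relprod : rel_prod y = rel_prod t by rewrite /rel_prod !ty.
rewrite relsum relprod rel_sum_slice // rel_prod_slice // in rel.
set s := slice_s _ _ _ _ _ _ in rel; set C := slice_C _ _ _ _ _ _ _ _ _ in rel.
set r := slice_rho _ _ _ in rel; set r' := slice_rho' _ _ _ in rel.
have rB : r - r' != 0 by rewrite slice_rhoB.
pose al := (y 8 - C - s * r') / (r - r'); pose be := s - al.
have y8 : C + al * r + be * r' = y 8.
  have -> : C + al * r + be * r' = al * (r - r') + (C + s * r').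
    by rewrite /be; ring.
  by rewrite divfK //; ring.
(* Given the choice of [al] and [be], the relation reads [(u * v * w - al * be) * (r - r') ^+ 2 =
   0], where [u], [v], [w] are the three factors on the right. *)
have cyc : al * be = (b2 * b3 - m1) * (b1 * b3 - m2) * (b1 * b2 - m3).
  apply/eqP; rewrite -subr_eq0 -(mulIr_eq0 _ (mulIf (expf_neq0 2 rB))).
  by apply/eqP; rewrite -[RHS]oppr0 -[in RHS]rel -y8 /be; ring.
have [b12 [b13 [b21 [b23 [b31 [b32 [u v w al_eq be_eq]]]]]]] := cycle_weights
  cyc.
pose a : 'rV[K]_3 := \row_(j < 3) nth 0 [:: a1; a2; a3] j.
pose B : 'M[K]_3 := \matrix_(i < 3, j < 3) nth 0
  (nth [::] [:: [:: b1; b12; b13]; [:: b21; b2; b23]; [:: b31; b32; b3]] i) j.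
have detB : \det B = 1.
  transitivity (b1 * b2 * b3 + al + be - b1 * (b2 * b3 - m1)
      - b2 * (b1 * b3 - m2) - b3 * (b1 * b2 - m3)).
    by rewrite det3 !mxE /= -al_eq -be_eq -u -v -w; ring.
  by rewrite /be /s /slice_s; ring.
exists (diag_mx a), B; split=> // [|i i9].
  by rewrite det_diag big_ord3 !mxE.
have a1' : a 0 0 * a 0 1 * a 0 2 = 1 by rewrite !mxE.
have [C0 C1 C2] := slice_diag_inv detB.
have aE : [/\ a 0 0 = a1, a 0 1 = a2 & a 0 2 = a3] by rewrite !mxE.
have BE : [/\ B 0 0 = b1, B 1 1 = b2 & B 2 2 = b3] by rewrite !mxE.
have CE : [/\ invmx B 0 0 = m1, invmx B 1 1 = m2 & invmx B 2 2 = m3].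
  by rewrite C0 C1 C2 !mxE /= u v w; split; ring.
case: aE BE CE => a_1 a_2 a_3 [b_1 b_2 b_3] [m_1 m_2 m_3].
move: i9; rewrite ltnS leq_eqVlt => /orP[/eqP ->|i8]; last first.
  by rewrite pair_traces_slice // a_1 a_2 a_3 b_1 b_2 b_3 m_1 m_2 m_3 -ty.
rewrite pair_traces_slice8 // a_1 a_2 a_3 b_1 b_2 b_3 m_1 m_2 m_3.
by rewrite !mxE /= al_eq be_eq.
Qed.

(** * The relation as a polynomial, and division by it *)

Lemma eq_rel_sum (K : comNzRingType) (y z : nat -> K) :
  (forall i, (i < 8)%N -> y i = z i) -> rel_sum y = rel_sum z.
Proof. by move=> yz; rewrite /rel_sum !yz. Qed.

Lemma eq_rel_prod (K : comNzRingType) (y z : nat -> K) :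
  (forall i, (i < 8)%N -> y i = z i) -> rel_prod y = rel_prod z.
Proof. by move=> yz; rewrite /rel_prod !yz. Qed.

Section RelationMorphism.
Variables (K L : comNzRingType) (f : {rmorphism K -> L}).

Ltac push_rmorph := repeat lazymatch goal with
  | |- _ (@GRing.add _ _ _) = _ => rewrite [LHS]rmorphD; apply: f_equal2
  | |- _ (@GRing.opp _ _) = _ => rewrite [LHS]rmorphN; apply: f_equal
  | |- _ (@GRing.mul _ _ _) = _ => rewrite [LHS]rmorphM; apply: f_equal2
  | |- _ (@GRing.exp _ _ _) = _ => rewrite [LHS]rmorphXn; apply: f_equal2
  | |- _ (@GRing.natmul _ _ _) = _ => exact: rmorph_nat
  | _ => reflexivity
  end.

Lemma rmorph_rel_sum y : f (rel_sum y) = rel_sum (f \o y).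
Proof. by rewrite /rel_sum; push_rmorph. Qed.

Lemma rmorph_rel_prod y : f (rel_prod y) = rel_prod (f \o y).
Proof. by rewrite /rel_prod; push_rmorph. Qed.

Lemma rmorph_disc3 e1 e2 : f (disc3 e1 e2) = disc3 (f e1) (f e2).
Proof. by rewrite /disc3; push_rmorph. Qed.

End RelationMorphism.

(** Indexing by [nat] lets the same expressions [rel_sum] and [rel_prod] be read in eight variables,
    in nine variables, or on numbers. *)
Definition mvar (K : comNzRingType) n (i : nat) : {mpoly K[n.+1]} := 'X_(inord
  i).

Lemma meval_mvar (K : comNzRingType) n (x : 'I_n.+1 -> K) i :
  (mvar K n i).@[x] = x (inord i).
Proof. exact: mevalXU. Qed.

Lemma muni_mvar (K : comNzRingType) n i : (i <= n)%N ->
  muni (mvar K n.+1 i) = (mvar K n i)%:P.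
Proof.
move=> lein; rewrite -muniX_widen; congr (muni 'X_[U_(_)]).
by apply/val_inj; rewrite /= !inordK // ltnS ltnW.
Qed.

Section RelationPoly.
Variable K : numClosedFieldType.

Definition sum_poly : {mpoly K[8]} := rel_sum (mvar K 7).
Definition prod_poly : {mpoly K[8]} := rel_prod (mvar K 7).

Definition rel_poly : {mpoly K[9]} :=
  'X_ord_max ^+ 2 - mwiden sum_poly * 'X_ord_max + mwiden prod_poly.

Lemma muni_mwiden n (p : {mpoly K[n]}) : muni (mwiden p) = p%:P.
Proof.
elim/mpolyind: p => [|c m p _ _ IH]; first by rewrite mwiden0 muni0.
rewrite mwidenD muniD IH polyCD; congr (_ + _).
rewrite mwidenZ mwidenX muniZ muniE msuppX big_seq1 mcoeffX eqxx scale1r.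
rewrite mnmwiden_ordmax expr0 alg_polyC -mul_polyC -polyCM mul_mpolyC.
congr (_ *: 'X_[_])%:P.
by apply/mnmP => i; rewrite mnmE mnmwiden_widen.
Qed.

Definition rel_uni : {poly {mpoly K[8]}} :=
  'X ^+ 2 - sum_poly%:P * 'X + prod_poly%:P.

Lemma muni_rel : muni rel_poly = rel_uni.
Proof.
rewrite /rel_poly muniD muniB !muniM !muni_mwiden muniX_max.
by rewrite /rel_uni expr2.
Qed.

Lemma rel_uni_evalE x (y : K) : (map_poly (meval x) rel_uni).[y] =
  y ^+ 2 - rel_sum (fun i => x (inord i)) * y
  + rel_prod (fun i => x (inord i)).
Proof.
rewrite /rel_uni !expr2 rmorphD rmorphB !rmorphM /= map_polyX !map_polyC /=.
rewrite !(hornerD, hornerN, hornerM, hornerX, hornerC).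
rewrite /sum_poly /prod_poly (rmorph_rel_sum (meval x)) (rmorph_rel_prod (meval
  x)).
by congr (_ - _ * _ + _); [apply: eq_rel_sum|apply: eq_rel_prod] => i _ /=;
  rewrite meval_mvar.
Qed.

Lemma meval_rel (x : 'I_9 -> K) : rel_poly.@[x] =
  x ord_max ^+ 2 - rel_sum (fun i => x (inord i)) * x ord_max
  + rel_prod (fun i => x (inord i)).
Proof.
rewrite meval_muni muni_rel rel_uni_evalE.
by congr (_ - _ * _ + _); [apply: eq_rel_sum|apply: eq_rel_prod] => i i8 /=;
  congr x; apply/val_inj; rewrite /= !inordK // ltnW.
Qed.

Definition rel_disc : {mpoly K[8]} := sum_poly ^+ 2 - 4 * prod_poly.

Lemma meval_rel_disc x : rel_disc.@[x] =
  rel_sum (fun i => x (inord i)) ^+ 2 - 4 * rel_prod (fun i => x (inord i)).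
Proof.
rewrite /rel_disc rmorphB rmorphXn rmorphM rmorph_nat /=.
rewrite /sum_poly /prod_poly (rmorph_rel_sum (meval x)) (rmorph_rel_prod (meval
  x)).
by congr (_ ^+ 2 - 4 * _); [apply: eq_rel_sum|apply: eq_rel_prod] => i _ /=;
  rewrite meval_mvar.
Qed.

(** Hence over a generic point of the eight-dimensional space the quadratic has two distinct
    roots. *)
Lemma rel_disc_neq0 : rel_disc != 0.
Proof.
apply: contraTneq isT => /(congr1 (meval (fun=> 0))).
rewrite meval0 meval_rel_disc.
have -> : rel_sum (fun=> 0) = - 3 :> K by rewrite /rel_sum; ring.
have -> : rel_prod (fun=> 0) = 9 :> K by rewrite /rel_prod; ring.
have -> : (- 3) ^+ 2 - 4 * 9 = - 27%:R :> K by ring.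
by move/eqP; rewrite oppr_eq0 pnatr_eq0.
Qed.

Lemma rel_uni_monic : rel_uni \is monic.
Proof.
rewrite monicE /rel_uni -addrA lead_coefDl ?lead_coefXn // size_polyXn.
rewrite (leq_ltn_trans (size_polyD _ _)) // gtn_max size_polyN.
rewrite (leq_ltn_trans (size_polyC_leq1 _)) // andbT.
by rewrite mul_polyC (leq_ltn_trans (size_scale_leq _ _)) ?size_polyX.
Qed.

Lemma size_rel_uni : size rel_uni = 3.
Proof.
rewrite /rel_uni -addrA size_polyDl ?size_polyXn //.
rewrite (leq_ltn_trans (size_polyD _ _)) // gtn_max size_polyN.
rewrite (leq_ltn_trans (size_polyC_leq1 _)) // andbT.
by rewrite mul_polyC (leq_ltn_trans (size_scale_leq _ _)) ?size_polyX.
Qed.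

(** Division by the monic quadratic [rel_uni]: modulo the relation, 1 and the last variable span
    everything over the polynomials in the first eight. *)
Lemma rel_reduce (p : {mpoly K[9]}) : exists q r0 r1,
  p = q * rel_poly + (mwiden r0 + mwiden r1 * 'X_ord_max).
Proof.
pose r := Pdiv.Ring.rmodp (muni p) rel_uni.
exists (of_muni (Pdiv.Ring.rdivp (muni p) rel_uni)), r`_0, r`_1.
rewrite -[LHS]muniK {1}(Pdiv.RingMonic.rdivp_eq rel_uni_monic (muni p)).
rewrite of_muniD of_muniM -/r -muni_rel muniK.
suff {1}-> : r = (r`_0)%:P + (r`_1)%:P * 'X.
  by rewrite of_muniD of_muniM !of_muniC of_muniX.
have sr : (size r <= 2)%N.
  have : (size r < size rel_uni)%N by rewrite Pdiv.Ring.ltn_rmodp monic_neq0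
    ?rel_uni_monic.
  by rewrite size_rel_uni.
apply/polyP => -[|[|i]]; rewrite !coefE /= ?mulr0 ?mulr1 ?addr0 ?add0r //.
by rewrite nth_default // (leq_trans sr).
Qed.

(** Where [d] and the discriminant are nonzero, a polynomial of degree at most 1 in the last
    variable vanishes at two distinct roots, so both coefficients are zero there. Multiplying them
    by [d * rel_disc] gives polynomials vanishing everywhere. *)
Lemma rel_reduced_eq0 (d r0 r1 : {mpoly K[8]}) : d != 0 ->
    (forall x : 'I_9 -> K, rel_poly.@[x] = 0 ->
       d.@[x \o widen_ord (leqnSn 8)] != 0 ->
       (mwiden r0 + mwiden r1 * 'X_ord_max).@[x] = 0) ->
  r0 = 0 /\ r1 = 0.
Proof.
move=> d0 r_0.
suff: (d * rel_disc) * r0 = 0 /\ (d * rel_disc) * r1 = 0.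
  have dd : d * rel_disc != 0 by rewrite mulf_neq0 // rel_disc_neq0.
  move=> [/eqP + /eqP]; rewrite !mulf_eq0 -mulf_eq0 (negPf dd) /=.
  by move=> /eqP -> /eqP ->.
suff r_eq0 x : d.@[x] != 0 -> rel_disc.@[x] != 0 -> r0.@[x] = 0 /\ r1.@[x] = 0.
  by split; apply: mpoly_eq0_meval => x; rewrite !mevalM;
    have [->|dx] := eqVneq d.@[x] 0; rewrite ?mul0r //;
    have [->|Dx] := eqVneq rel_disc.@[x] 0; rewrite ?mulr0 ?mul0r //;
    have [e0 e1] := r_eq0 x dx Dx; rewrite ?e0 ?e1 mulr0.
move=> dx; rewrite meval_rel_disc.
set S := rel_sum _; set Q := rel_prod _ => Dx.
pose rt := sqrtC (S ^+ 2 - 4 * Q).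
have rtE : rt ^+ 2 = S ^+ 2 - 4 * Q by rewrite sqrtCK.
have rt0 : rt != 0 by rewrite sqrtC_eq0.
have root_r y : y ^+ 2 - S * y + Q = 0 -> r0.@[x] + r1.@[x] * y = 0.
  move=> ry; have := r_0 (rcons_ord x y).
  have xE : rcons_ord x y \o widen_ord (leqnSn 8) = x.
    by apply/funext => j /=; rewrite rcons_ord_widen.
  rewrite meval_muni muni_rel rel_uni_evalE rcons_ord_max xE => /(_ ry dx).
  by rewrite mevalD mevalM !meval_mwiden mevalXU rcons_ord_max xE.
have root_t t : t ^+ 2 = S ^+ 2 - 4 * Q ->
    r0.@[x] + r1.@[x] * ((S + t) / 2) = 0.
  move=> tE; apply: root_r.
  have -> : ((S + t) / 2) ^+ 2 - S * ((S + t) / 2) + Q =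
      (t ^+ 2 - (S ^+ 2 - 4 * Q)) / 4 by field.
  by rewrite tE subrr mul0r.
have e1 := root_t _ rtE.
have e2 : r0.@[x] + r1.@[x] * ((S - rt) / 2) = 0 by apply: root_t;
  rewrite sqrrN.
have r1_eq0 : r1.@[x] = 0.
  apply: (mulIf rt0); rewrite mul0r.
  transitivity ((r0.@[x] + r1.@[x] * ((S + rt) / 2))
    - (r0.@[x] + r1.@[x] * ((S - rt) / 2))); first by field.
  by rewrite e1 e2 subrr.
by split=> //; rewrite r1_eq0 mul0r addr0 in e1.
Qed.

(** The remainder of [p] vanishes at the same points as [p], hence is zero. The factor [d] makes it
    enough to know those zeros of the relation that come from pairs of matrices. *)
Lemma rel_divides (d : {mpoly K[8]}) (p : {mpoly K[9]}) : d != 0 ->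
    (forall x : 'I_9 -> K, rel_poly.@[x] = 0 ->
       d.@[x \o widen_ord (leqnSn 8)] != 0 -> p.@[x] = 0) ->
  exists q, p = q * rel_poly.
Proof.
have [q [r0 [r1 pE]]] := rel_reduce p; move=> d0 p0.
have [r0_0 r1_0] : r0 = 0 /\ r1 = 0.
  apply: (rel_reduced_eq0 d0) => x Fx dx.
  by rewrite -[RHS](p0 x Fx dx) pE [RHS]mevalD mevalM Fx mulr0 add0r.
by exists q; rewrite pE r0_0 r1_0 mwiden0 mul0r !addr0.
Qed.

End RelationPoly.

Lemma SL_det (K : fieldType) n (x : SL K n) : \det (\val x) = 1.
Proof. exact: eqP (valP x). Qed.

Lemma SL_unitmx (K : fieldType) n (x : SL K n) : \val x \in unitmx.
Proof. by rewrite unitmxE SL_det unitr1. Qed.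

(** * Regular functions and conjugation *)

Section Regular.
Variable K : numClosedFieldType.
Implicit Types f g : SL K 3 * SL K 3 -> K^o.

Local Notation is_regular f :=
  (coordinate_ring (f : SL K 3 * SL K 3 -> K^o)).

Lemma regularC (c : K) : is_regular (fun=> c ).
Proof. by exists c%:MP => x; rewrite mevalC. Qed.

Lemma regularD f g : is_regular f -> is_regular g ->
  is_regular (fun x => f x + g x).
Proof. by move=> [p fp] [q gq]; exists (p + q) => x; rewrite mevalD fp gq. Qed.

Lemma regularM f g : is_regular f -> is_regular g ->
  is_regular (fun x => f x * g x).
Proof. by move=> [p fp] [q gq]; exists (p * q) => x; rewrite mevalM fp gq. Qed.

Lemma regularB f g : is_regular f -> is_regular g ->
  is_regular (fun x => f x - g x).
Proof. by move=> [p fp] [q gq]; exists (p - q) => x; rewrite mevalB fp gq. Qed.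

Lemma regular_fst i j : is_regular (fun x => \val x.1 i j ).
Proof.
exists 'X_(lshift (3 * 3) (mxvec_index i j)) => x.
by rewrite mevalXU /pair_coords row_mxEl mxvecE.
Qed.

Lemma regular_snd i j : is_regular (fun x => \val x.2 i j ).
Proof.
exists 'X_(rshift (3 * 3) (mxvec_index i j)) => x.
by rewrite mevalXU /pair_coords row_mxEr mxvecE.
Qed.

Lemma regular_meval n (p : {mpoly K[n]}) (h : SL K 3 * SL K 3 -> 'I_n -> K) :
  (forall i, is_regular (fun x => h x i )) ->
  is_regular (fun x => p.@[h x] ).
Proof.
move=> hr; apply: (meval_closed (Q := fun f => is_regular f)) => //.
- exact: regularC.
- exact: regularD.
- exact: regularM.
Qed.

Definition regular_mx (M : SL K 3 * SL K 3 -> 'M[K]_3) :=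
  forall i j, is_regular (fun x => M x i j ).

Lemma regular_mulmx M N : regular_mx M -> regular_mx N ->
  regular_mx (fun x => M x *m N x).
Proof.
move=> rM rN i j; under eq_fun do rewrite mulmx3.
by do ?apply: regularD; apply: regularM.
Qed.

Lemma regular_adj3 M : regular_mx M -> regular_mx (fun x => adj3 (M x)).
Proof.
move=> rM i j; under eq_fun do rewrite mxE.
by apply: regularB; apply: regularM.
Qed.

Lemma regular_trace M : regular_mx M -> is_regular (fun x => \tr (M x) ).
Proof.
by move=> rM; under eq_fun do rewrite mxtrace3; do ?apply: regularD.
Qed.

Definition traces_of (x : SL K 3 * SL K 3) : 'I_9 -> K :=
  pair_point (\val x.1) (\val x.2).

Lemma regular_traces i : is_regular (fun x => traces_of x i ).
Proof.
have r1 : regular_mx (fun x => \val x.1) by exact: regular_fst.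
have r2 : regular_mx (fun x => \val x.2) by exact: regular_snd.
have r1' : regular_mx (fun x => invmx (\val x.1)).
  move=> j k; under eq_fun do rewrite (invmx3 (SL_det _)).
  exact: regular_adj3.
have r2' : regular_mx (fun x => invmx (\val x.2)).
  move=> j k; under eq_fun do rewrite (invmx3 (SL_det _)).
  exact: regular_adj3.
rewrite /traces_of /pair_point /pair_traces; case: i => i /= i9.
do 9?[case: i i9 => [|i] i9 /=; first by apply: regular_trace => //;
  do ?apply: regular_mulmx].
by [].
Qed.

End Regular.

(** * Invariance under conjugation, and diagonalization *)

Section ConjugationInvariance.
Variable K : numClosedFieldType.

Lemma conj_mulmx n (P A B : 'M[K]_n) : P \in unitmx ->
  (invmx P *m A *m P) *m (invmx P *m B *m P) = invmx P *m (A *m B) *m P.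
Proof. by move=> Pu; rewrite !mulmxA mulmxK. Qed.

Lemma invmx_conj n (P A : 'M[K]_n) : P \in unitmx -> A \in unitmx ->
  invmx (invmx P *m A *m P) = invmx P *m invmx A *m P.
Proof.
move=> Pu Au; suff e : (invmx P *m A *m P) *m (invmx P *m invmx A *m P) = 1%:M.
  have /mulmx1_unit[Cu _] := e.
  by rewrite -[LHS]mulmx1 -e mulKmx.
by rewrite conj_mulmx // mulmxV // mulmx1 mulVmx.
Qed.

Lemma mxtrace_conj n (P A : 'M[K]_n) : P \in unitmx ->
  \tr (invmx P *m A *m P) = \tr A.
Proof. by move=> Pu; rewrite mxtrace_mulC mulKVmx. Qed.

Lemma pair_traces_conj (P A B : 'M[K]_3) i : P \in unitmx ->
    A \in unitmx -> B \in unitmx ->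
  pair_traces (invmx P *m A *m P) (invmx P *m B *m P) i = pair_traces A B i.
Proof.
move=> Pu Au Bu; rewrite /pair_traces !invmx_conj // !conj_mulmx //.
by rewrite !mxtrace_conj.
Qed.

Lemma traces_of_conj (g : SL K 3) x :
  traces_of (SL_conj g x.1, SL_conj g x.2) = traces_of x.
Proof.
by apply/funext => i;
  rewrite /traces_of /pair_point /= pair_traces_conj ?SL_unitmx.
Qed.

(** Scalars act trivially, so [P] may be divided by a cube root of its determinant to land in
    SL(3). *)
Lemma SL_act_GL (f : SL K 3 * SL K 3 -> K^o) (P : 'M[K]_3) (x y : SL K 3 * SL K
  3) :
    (forall g, SL_act g f = f) -> P \in unitmx ->
    \val y.1 = invmx P *m \val x.1 *m P -> \val y.2 = invmx P *m \val x.2 *m P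
      ->
  f y = f x.
Proof.
move=> finv Pu y1 y2.
have dP : \det P != 0 by rewrite -unitfE -unitmxE.
pose r := 3.-root (\det P).
have rE : r ^+ 3 = \det P by rewrite rootCK.
have r0 : r != 0 by rewrite rootC_eq0.
have dg : \det (r^-1 *: P) == 1 by rewrite detZ exprVn rE mulVf.
pose g : SL K 3 := exist _ (r^-1 *: P) dg.
have -> : y = (SL_conj g x.1, SL_conj g x.2).
  case: y y1 y2 => [u v] /= u1 v1.
  have ginv : invmx (r^-1 *: P) = r *: invmx P.
    by rewrite invmxZ ?invrK // scaler_unit // unitfE invr_eq0.
  by congr (_, _); apply/val_inj; rewrite /= ?u1 ?v1 ginv -scalemxAr -!scalemxAl
    scalerA mulVf // scale1r.
by rewrite -[in RHS](finv g).
Qed.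

End ConjugationInvariance.

Section Diagonalization.
Variable K : numClosedFieldType.

Lemma char_poly3 (A : 'M[K]_3) : \det A = 1 ->
  char_poly A = 'X^3 - (\tr A)%:P * 'X^2 + (\tr (invmx A))%:P * 'X - 1.
Proof.
move=> A1; rewrite (invmx3 A1) /char_poly -[in RHS]polyC1 -A1.
rewrite !mxtrace3 !det3 !adj3E /= ?mulr1n ?mulr0n.
by rewrite !(polyCD, polyCN, polyCM); ring.
Qed.

(** The characteristic polynomial has three distinct roots and is divisible by the minimal
    polynomial, which makes [A] diagonalizable. *)
Lemma diagonalize3 (A : 'M[K]_3) : \det A = 1 ->
    disc3 (\tr A) (\tr (invmx A)) != 0 ->
  exists P a, [/\ P \in unitmx, A = invmx P *m diag_mx a *m P,
    a 0 0 * a 0 1 * a 0 2 = 1 & vdm3 (a 0 0) (a 0 1) (a 0 2) != 0].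
Proof.
move=> A1 D0; have [a1 [a2 [a3 [e1 e2 a123]]]] := cubic_roots (\tr A) (\tr
  (invmx A)).
have V0 : vdm3 a1 a2 a3 != 0.
  by move: D0; rewrite -e1 -e2 -vdm3_sqr // expf_eq0.
have /diagonalizableP : exists2 rs, uniq rs &
    mxminpoly A %| \prod_(x <- rs) ('X - x%:P).
  exists [:: a1; a2; a3].
    move: V0; rewrite /vdm3 !mulf_eq0 !negb_or !subr_eq0 /= !inE negb_or.
    by rewrite [a3 == a1]eq_sym => /andP[/andP[-> ->] ->].
  suff -> : \prod_(x <- [:: a1; a2; a3]) ('X - x%:P) = char_poly A.
    exact: mxminpoly_dvd_char.
  rewrite char_poly3 // -e1 -e2 !big_cons big_nil -[X in _ + _ * 'X - X]polyC1
    -a123.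
  by rewrite !(polyCD, polyCM); ring.
case=> P Pu /diagonalizable_forPex[a /(simmxP Pu) PA]; exists P, a.
have AE : A = invmx P *m diag_mx a *m P by rewrite -mulmxA -PA mulKmx.
have aa : a 0 0 * a 0 1 * a 0 2 = 1.
  by rewrite -[RHS]A1 AE !det_mulmx det_inv [RHS]mulrAC mulVf ?mul1r ?det_diag
    ?big_ord3 //;
    rewrite -unitfE -unitmxE.
split=> //.
have da : \det (diag_mx a) = 1 by rewrite det_diag big_ord3.
have au : diag_mx a \in unitmx by rewrite unitmxE da unitr1.
(* The entries of [a] have not been matched with [a1], [a2], [a3]; that they are distinct is read
   off the discriminant, which conjugation preserves. *)
move: D0; rewrite AE invmx_conj // !mxtrace_conj // (invmx3 da).
rewrite !mxtrace3 !adj3E /= ?mulr1n ?mulr0n => D0.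
have : vdm3 (a 0 0) (a 0 1) (a 0 2) ^+ 2 != 0.
  apply: contraNneq D0 => V2; apply/eqP; rewrite -[RHS]V2 vdm3_sqr //.
  by congr disc3; ring.
by rewrite expf_eq0.
Qed.

End Diagonalization.

(** * Density of the pairs whose first matrix has distinct eigenvalues *)

Section Density.
Variable K : numClosedFieldType.
Local Notation is_regular f :=
  (coordinate_ring (f : SL K 3 * SL K 3 -> K^o)).

(** The form taken by regular functions along [curve] below, whose first column is divided by the
    determinant of the line. *)
Definition rational_in (d : {poly K}) (phi : K -> K) :=
  exists N (q : {poly K}), forall z, d.[z] != 0 -> d.[z] ^+ N * phi z = q.[z].

Lemma rational_horner d (p : {poly K}) : rational_in d (fun z => p.[z]).
Proof. by exists 0, p => z _; rewrite mul1r. Qed.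

Lemma rational_inv d : rational_in d (fun z => d.[z]^-1).
Proof. by exists 1, 1%:P => z dz; rewrite expr1 mulfV // hornerC. Qed.

Lemma rationalD d f g : rational_in d f -> rational_in d g ->
  rational_in d (fun z => f z + g z).
Proof.
move=> [M [p fp]] [N [q gq]];
  exists (M + N)%N, (d ^+ N * p + d ^+ M * q) => z dz.
by rewrite hornerD !hornerM !horner_exp -fp // -gq // exprD; ring.
Qed.

Lemma rationalM d f g : rational_in d f -> rational_in d g ->
  rational_in d (fun z => f z * g z).
Proof.
move=> [M [p fp]] [N [q gq]]; exists (M + N)%N, (p * q) => z dz.
by rewrite hornerM -fp // -gq // exprD; ring.
Qed.

(** Nonzero exactly when the first matrix has three distinct eigenvalues. *)
Definition generic_disc (x : SL K 3 * SL K 3) : K :=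
  disc3 (\tr (\val x.1)) (\tr (invmx (\val x.1))).

Lemma generic_discE x : generic_disc x =
  (disc3 (mvar K 8 7) (mvar K 8 0)).@[traces_of x].
Proof.
by rewrite (rmorph_disc3 (meval _)) /= !meval_mvar /traces_of /pair_point
  !inordK.
Qed.

Lemma regular_generic_disc : is_regular generic_disc.
Proof.
rewrite (_ : generic_disc = fun x => (disc3 (mvar K 8 7) (mvar K 8
  0)).@[traces_of x]).
  by apply: regular_meval; exact: regular_traces.
by apply/funext => x; rewrite generic_discE.
Qed.

(* A line of matrices through A and the companion matrix of X^3 - 1, with the
   first column rescaled so as to stay in SL(3). *)
Section Curve.
Variables A B : 'M[K]_3.

Definition cycle_mx : 'M[K]_3 := \matrix_(i, j) (j == i + 1)%:R.
Definition line_mx : 'M[{poly K}]_3 :=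
  \matrix_(i, j) ((1 - 'X) * (A i j)%:P + 'X * (cycle_mx i j)%:P).
Let M := line_mx.
Definition line_det := \det M.
Let d := line_det.

Definition curve z : 'M[K]_3 :=
  \matrix_(i, j) ((M i j).[z] * if j == 0 then d.[z]^-1 else 1).

Lemma curve_rational (p : {mpoly K[3 * 3 + 3 * 3]}) :
  rational_in d (fun z => p.@[row_mx (mxvec (curve z)) (mxvec B) ord0]).
Proof.
apply: meval_closed => [c|f g|f g|k].
- rewrite (_ : (fun=> c) = fun z => (c%:P).[z]); first exact: rational_horner.
  by apply/funext => z; rewrite hornerC.
- exact: rationalD.
- exact: rationalM.
case: (split_ordP k) => {}k ->; case/mxvec_indexP: k => i j.
  under eq_fun do rewrite row_mxEl mxvecE mxE.
  apply: rationalM; first exact: rational_horner.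
  case: (j == 0); first exact: rational_inv.
  rewrite (_ : (fun=> 1) = fun z : K => (1%:P).[z]);
    first exact: rational_horner.
  by apply/funext => z; rewrite hornerC.
under eq_fun do rewrite row_mxEr mxvecE.
rewrite (_ : (fun=> B i j) = fun z => ((B i j)%:P).[z]);
  first exact: rational_horner.
by apply/funext => z; rewrite hornerC.
Qed.

Lemma det_curve z : d.[z] != 0 -> \det (curve z) = 1.
Proof.
move=> dz; transitivity (d.[z] * d.[z]^-1); last by rewrite mulfV.
have cE i j : curve z i j = (M i j).[z] * if j == 0 then d.[z]^-1 else 1.
  by rewrite mxE.
rewrite [LHS]det3 !cE /=; move: (d.[z]^-1) => c.
by rewrite /d /line_det det3 !(hornerD, hornerN, hornerM); ring.
Qed.

Lemma curve0 : \det A = 1 -> curve 0 = A /\ d.[0] = 1.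
Proof.
move=> A1; have M0 i j : (M i j).[0] = A i j.
  by rewrite mxE !hornerE; ring.
have d0 : d.[0] = 1.
  by rewrite -A1 /d /line_det !det3 !(hornerD, hornerN, hornerM) !M0.
split=> //; apply/matrixP => i j.
by rewrite mxE M0 d0 invr1; case: ifP; rewrite mulr1.
Qed.

(** At 1 the curve reaches the cyclic permutation matrix, with characteristic polynomial [X^3 - 1]
    of discriminant -27: a point known to be generic. *)
Lemma curve1 : [/\ d.[1] = 1, \tr (curve 1) = 0 & \tr (adj3 (curve 1)) = 0].
Proof.
have M1 i j : (M i j).[1] = (j == i + 1)%:R.
  by rewrite !mxE !hornerE; ring.
have d1 : d.[1] = 1.
  by rewrite /d /line_det !det3 !(hornerD, hornerN, hornerM) !M1 /=; ring.
have -> : curve 1 = cycle_mx.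
  by apply/matrixP => i j; rewrite mxE M1 d1 invr1 mxE; case: ifP;
    rewrite mulr1.
by split=> //; rewrite mxtrace3 !adj3E /=; ring.
Qed.

End Curve.

(** Along the curve from [A] to the cyclic permutation matrix, with [B] fixed, [f] and the
    discriminant become polynomials [q] and [s] up to powers of [d]. Then [q * s * d = 0], while [s]
    is nonzero at 1 and [d] at 0, so [q = 0] and [f] vanishes at the starting point. *)
Lemma regular_eq0_generic f : is_regular f ->
  (forall x, generic_disc x != 0 -> f x = 0) -> forall x, f x = 0.
Proof.
move=> [p fp] f0 [A B]; have [r dr] := regular_generic_disc.
have [N [q qE]] := curve_rational (\val A) (\val B) p.
have [N' [s sE]] := curve_rational (\val A) (\val B) r.
pose d := line_det (\val A).
have [A1 d0] := curve0 (SL_det A).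
have [d1 tr1 tr1'] := curve1 (\val A).
have curve_SL z (dz : d.[z] != 0) : exists x : SL K 3 * SL K 3,
    \val x.1 = curve (\val A) z /\ \val x.2 = \val B.
  by have /eqP cz := det_curve dz;
    exists ((exist _ (curve (\val A) z) cz : SL K 3), B).
have qE' z : d.[z] != 0 -> exists x, d.[z] ^+ N * f x = q.[z] /\
    d.[z] ^+ N' * generic_disc x = s.[z] /\ \val x.1 = curve (\val A) z.
  move=> dz; have [x [x1 x2]] := curve_SL z dz; exists x.
  by rewrite fp dr /pair_coords x1 x2 qE ?sE.
have /eqP : q * s * d = 0.
  apply: poly_eq0_horner => z; rewrite !hornerM.
  have [->|dz] := eqVneq d.[z] 0; first by rewrite mulr0.
  have [x [<- [<- _]]] := qE' z dz.
  have [->|gx] := eqVneq (generic_disc x) 0; first by rewrite mulr0 mulr0 mul0r.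
  by rewrite f0 // mulr0 !mul0r.
rewrite !mulf_eq0 => /orP[/orP[]|] /eqP e0.
- have := qE 0; rewrite d0 oner_eq0 A1 e0 horner0 expr1n mul1r => /(_ isT) p0.
  by rewrite fp.
- have [|x [_ [sx x1]]] := qE' 1; first by rewrite d1 oner_eq0.
  have detx : \det (curve (\val A) 1) = 1 by apply: det_curve;
    rewrite d1 oner_eq0.
  move: sx; rewrite d1 expr1n mul1r e0 horner0 /generic_disc x1 tr1 invmx3 //
    tr1'.
  have -> : disc3 0 0 = - 27%:R :> K by rewrite /disc3; ring.
  by move/eqP; rewrite oppr_eq0 pnatr_eq0.
- by move: d0; rewrite -/d e0 horner0 => /esym /eqP; rewrite oner_eq0.
Qed.

(** By density and conjugation it suffices to look at the slice, where the ninth trace is visibly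
    one of the two roots of the quadratic. *)
Lemma rel_traces_of x : (rel_poly K).@[traces_of x] = 0.
Proof.
move: x; apply: regular_eq0_generic => [|x gx].
  by apply: regular_meval; exact: regular_traces.
have [P [a [Pu xE a123 V0]]] := diagonalize3 (SL_det x.1) gx.
have au : diag_mx a \in unitmx by rewrite unitmxE det_diag big_ord3 /= a123
  unitr1.
pose B := P *m \val x.2 *m invmx P.
have BE : \val x.2 = invmx P *m B *m P by rewrite /B !mulmxA mulVmx // mul1mx
  mulmxKV.
have detB : \det B = 1.
  rewrite !det_mulmx det_inv mulrAC mulfV ?mul1r ?SL_det //.
  by rewrite -unitfE -unitmxE.
have Bu : B \in unitmx by rewrite unitmxE detB unitr1.
have tE i : traces_of x i = pair_traces (diag_mx a) B i.
  by rewrite /traces_of /pair_point xE BE pair_traces_conj.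
rewrite meval_rel !tE.
have sE i : (i < 8)%N -> traces_of x (inord i) = slice_traces (a 0 0) (a 0 1) (a
  0 2)
    (B 0 0) (B 1 1) (B 2 2) (invmx B 0 0) (invmx B 1 1) (invmx B 2 2) i.
  by move=> i8; rewrite tE inordK ?pair_traces_slice // ltnW.
rewrite (eq_rel_sum sE) (eq_rel_prod sE) rel_sum_slice // rel_prod_slice //.
rewrite -slice_cycle_sum // -slice_cycle_prod // pair_traces_slice8 //.
by ring.
Qed.

End Density.

(** * Invariants on the diagonal slice *)

Section TorusInvariants.
Variable K : numClosedFieldType.

Definition monomial3 : Type :=
  (K * ('I_3 -> nat) * ('I_3 -> 'I_3 -> nat))%type.

Definition eval_mon (l : monomial3) (a : 'rV[K]_3) (B : 'M[K]_3) : K :=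
  l.1.1 * (\prod_i a 0 i ^+ l.1.2 i) * \prod_i \prod_j B i j ^+ l.2 i j.

Lemma poly_monomials (p : {mpoly K[3 * 3 + 3 * 3]}) :
  exists s : seq monomial3, forall a B,
    p.@[row_mx (mxvec (diag_mx a)) (mxvec B) ord0] = \sum_(l <- s) eval_mon l a
      B.
Proof.
pose Q (f : 'rV[K]_3 * 'M[K]_3 -> K) :=
  exists s : seq monomial3, forall t, f t = \sum_(l <- s) eval_mon l t.1 t.2.
suff [s sE] : Q (fun t => p.@[row_mx (mxvec (diag_mx t.1)) (mxvec t.2) ord0]).
  by exists s => a B; rewrite (sE (a, B)).
have prod1 (I : finType) (F : I -> K) : \prod_i F i ^+ 0 = 1.
  by rewrite big1 // => i _; rewrite expr0.
have prod_delta (F : 'I_3 -> K) i : \prod_j F j ^+ (j == i) = F i.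
  rewrite (bigD1 i) //= eqxx expr1 big1 ?mulr1 // => j /negPf ->.
  by rewrite expr0.
apply: meval_closed => [c|f g [s fs] [r gr]|f g [s fs] [r gr]|k].
- exists [:: (c, fun=> 0%N, fun _ _ => 0%N)] => t.
  rewrite big_seq1 /eval_mon /= prod1 big1 ?mulr1 // => i _; exact: prod1.
- by exists (s ++ r) => t; rewrite big_cat /= fs gr.
- exists [seq (l.1.1 * m.1.1, fun i => (l.1.2 i + m.1.2 i)%N,
    fun i j => (l.2 i j + m.2 i j)%N) | l <- s, m <- r] => t.
  rewrite fs gr big_allpairs_dep /= mulr_suml; apply: eq_bigr => l _.
  rewrite mulr_sumr; apply: eq_bigr => m _; rewrite /eval_mon /=.
  under [X in _ = _ * X * _]eq_bigr do rewrite exprD.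
  under [X in _ = _ * X]eq_bigr do under eq_bigr do rewrite exprD.
  under [X in _ = _ * X]eq_bigr do rewrite big_split /=.
  by rewrite !big_split /=; ring.
case: (split_ordP k) => {}k ->; case/mxvec_indexP: k => i j.
  have [->|nij] := eqVneq i j; last first.
    exists [::] => t; rewrite big_nil row_mxEl mxvecE mxE.
    by rewrite (negPf nij) mulr0n.
  exists [:: (1, fun k => k == j : nat, fun _ _ => 0%N)] => t.
  rewrite row_mxEl mxvecE mxE eqxx mulr1n big_seq1 /eval_mon /= prod_delta.
  by rewrite mul1r big1 ?mulr1 // => k _; exact: prod1.
exists [:: (1, fun=> 0%N, fun k l => ((k == i) * (l == j))%N)] => t.
rewrite row_mxEr mxvecE big_seq1 /eval_mon /= prod1 !mul1r.
rewrite -[LHS](prod_delta (fun k => t.2 k j) i); apply: eq_bigr => k _.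
case: (k == i); last by rewrite prod1 expr0.
by rewrite expr1; under eq_bigr do rewrite mul1n; rewrite prod_delta.
Qed.

Lemma eq_sum_all (I : Type) (V : nmodType) (s : seq I) (P : pred I) (F G : I ->
  V) :
  all P s -> (forall i, P i -> F i = G i) -> \sum_(i <- s) F i = \sum_(i <- s) G
    i.
Proof.
move=> + FG; elim: s => [|i s IH] /=; first by rewrite !big_nil.
by case/andP => Pi Ps; rewrite !big_cons FG // IH.
Qed.

(** A Laurent polynomial constant on nonzero [t] equals its coefficient of degree 0; multiplication
    by [t ^+ N] reduces this to polynomials. *)
Lemma laurent_const (I : Type) (s : seq I) (c : I -> K) (m n : I -> nat) C :
    (forall t, t != 0 -> \sum_(i <- s) c i * (t ^+ m i / t ^+ n i) = C) ->
  \sum_(i <- s | m i == n i) c i = C.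
Proof.
move=> sC; have [N leN] : exists N, all (fun i => n i <= N)%N s.
  elim: (s) => [|i r [N leN]]; first by exists 0%N.
  exists (maxn (n i) N); rewrite /= leq_maxl; apply: sub_all leN => j jN.
  by rewrite (leq_trans jN) // leq_maxr.
pose q : {poly K} := \sum_(i <- s) c i *: 'X^(m i + N - n i) - C *: 'X^N.
(* The factor ['X] takes care of [t = 0], where the hypothesis says nothing. *)
have /eqP : q * 'X = 0.
  apply: poly_eq0_horner => t; rewrite hornerM hornerX.
  have [->|t0] := eqVneq t 0; first by rewrite mulr0.
  suff -> : q.[t] = 0 by rewrite mul0r.
  rewrite hornerD hornerN hornerZ hornerXn horner_sum -(sC t t0) mulr_suml.
  apply/eqP; rewrite subr_eq0; apply/eqP; apply: eq_sum_all leN _ => i niN.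
  rewrite hornerZ hornerXn -addnBA // exprD -mulrA; congr (_ * _).
  rewrite -mulrA; congr (_ * _); apply: (mulfI (expf_neq0 (n i) t0)).
  by rewrite mulrA mulfV ?expf_neq0 // mul1r -exprD subnKC.
rewrite mulf_eq0 polyX_eq0 orbF => /eqP q0.
have := congr1 (fun p : {poly K} => p`_N) q0;
  rewrite coef0 coefB coefZ coefXn eqxx mulr1 => /eqP.
rewrite subr_eq0 => /eqP <-; rewrite coef_sum big_mkcond /=.
apply: eq_sum_all leN _ => i niN; rewrite coefZ coefXn -addnBA //.
have -> : (N == m i + (N - n i))%N = (m i == n i).
  by apply/eqP/eqP; lia.
by case: eqP; rewrite ?mulr1 ?mulr0.
Qed.

(** Weight zero under conjugation by the one-parameter group [diag(t ^+ w i)], which scales [B i j]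
    by [t ^+ w j / t ^+ w i]. *)
Definition balanced (w : 'I_3 -> nat) (l : monomial3) :=
  (\sum_i \sum_j l.2 i j * w j == \sum_i \sum_j l.2 i j * w i)%N.

Lemma eval_mon_conj (w : 'I_3 -> nat) (t : K) l a (B : 'M[K]_3) : t != 0 ->
  eval_mon l a (\matrix_(i, j) (B i j * (t ^+ w j / t ^+ w i))) =
  eval_mon l a B * (t ^+ (\sum_i \sum_j l.2 i j * w j)%N
    / t ^+ (\sum_i \sum_j l.2 i j * w i)%N).
Proof.
move=> t0; rewrite /eval_mon -[RHS]mulrA; congr (_ * _).
rewrite !expr_sum -prodf_div -big_split /=; apply: eq_bigr => i _.
rewrite !expr_sum -prodf_div -big_split /=; apply: eq_bigr => j _.
by rewrite mxE exprMn expr_div_n -!exprM ![(w _ * _)%N]mulnC.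
Qed.

End TorusInvariants.

(** * Functions on the slice with Vandermonde denominators *)

Section SliceFunctions.
Variable K : numClosedFieldType.

Definition slice : Type := {t : 'rV[K]_3 * 'M[K]_3 |
  (t.1 0 0 * t.1 0 1 * t.1 0 2 == 1) && (\det t.2 == 1)}.
Implicit Types (t : slice) (f g : slice -> K).

Definition sl_a t : 'rV[K]_3 := (\val t).1.
Definition sl_B t : 'M[K]_3 := (\val t).2.
Definition sl_V t : K := vdm3 (sl_a t 0 0) (sl_a t 0 1) (sl_a t 0 2).
Definition sl_T t : 'I_9 -> K := pair_point (diag_mx (sl_a t)) (sl_B t).

Lemma sl_a1 t : sl_a t 0 0 * sl_a t 0 1 * sl_a t 0 2 = 1.
Proof. by have /andP[/eqP] := valP t. Qed.

Lemma sl_B1 t : \det (sl_B t) = 1.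
Proof. by have /andP[_ /eqP] := valP t. Qed.

(** A polynomial in the traces times a monomial in the eigenvalues; the monomial is kept apart so
    that it can be symmetrized later. *)
Definition term3 : Type := ({mpoly K[9]} * (nat * nat * nat))%type.

Definition eval_term (l : term3) (x : 'I_9 -> K) (a1 a2 a3 : K) : K :=
  l.1.@[x] * (a1 ^+ l.2.1.1 * a2 ^+ l.2.1.2 * a3 ^+ l.2.2).

Definition slice_poly f := exists s : seq term3, forall t, f t =
  \sum_(l <- s) eval_term l (sl_T t) (sl_a t 0 0) (sl_a t 0 1) (sl_a t 0 2).

Lemma slice_polyC c : slice_poly (fun=> c).
Proof.
exists [:: (c%:MP, (0, 0, 0)%N)] => t.
by rewrite big_seq1 /eval_term /= mevalC !expr0 !mulr1.
Qed.

Lemma slice_polyT (i : 'I_9) : slice_poly (fun t => sl_T t i).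
Proof.
exists [:: ('X_i, (0, 0, 0)%N)] => t.
by rewrite big_seq1 /eval_term /= mevalXU !expr0 !mulr1.
Qed.

Lemma slice_polya (i : 'I_3) : slice_poly (fun t => sl_a t 0 i).
Proof.
elim/ord3P: i;
  [exists [:: (1, (1, 0, 0)%N)]|exists [:: (1, (0, 1, 0)%N)]
  |exists [:: (1, (0, 0, 1)%N)]] => t;
  by rewrite big_seq1 /eval_term /= meval1 !expr0 expr1 ?mulr1 ?mul1r.
Qed.

Lemma slice_polyD f g : slice_poly f -> slice_poly g ->
  slice_poly (fun t => f t + g t).
Proof. by move=> [s fs] [r gr]; exists (s ++ r) => t;
  rewrite big_cat fs gr. Qed.

Lemma slice_polyM f g : slice_poly f -> slice_poly g ->
  slice_poly (fun t => f t * g t).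
Proof.
move=> [s fs] [r gr].
exists [seq (l.1 * m.1, (l.2.1.1 + m.2.1.1, l.2.1.2 + m.2.1.2, l.2.2 + m.2.2)%N)
  | l <- s, m <- r] => t.
rewrite fs gr big_allpairs_dep /= mulr_suml; apply: eq_bigr => l _.
rewrite mulr_sumr; apply: eq_bigr => m _.
by rewrite /eval_term /= mevalM !exprD; ring.
Qed.

Lemma slice_polyN f : slice_poly f -> slice_poly (fun t => - f t).
Proof.
move=> pf; rewrite (_ : (fun t => _) = fun t => -1 * f t).
  by apply: slice_polyM pf; exact: slice_polyC.
by apply/funext => t; rewrite mulN1r.
Qed.

Lemma slice_polyX f n : slice_poly f -> slice_poly (fun t => f t ^+ n).
Proof.
move=> pf; elim: n => [|n IH]; first exact: slice_polyC.
by under eq_fun do rewrite exprS; exact: slice_polyM.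
Qed.

Lemma slice_polyV : slice_poly sl_V.
Proof.
rewrite /sl_V /vdm3; do ?apply: slice_polyM; apply: slice_polyD;
  rewrite ?slice_polyN //; do ?apply: slice_polyN; exact: slice_polya.
Qed.

Definition slice_frac f := exists k, slice_poly (fun t => sl_V t ^+ k * f t).

Lemma slice_frac_poly f : slice_poly f -> slice_frac f.
Proof. by move=> pf; exists 0%N; under eq_fun do rewrite expr0 mul1r. Qed.

Lemma slice_fracC c : slice_frac (fun=> c).
Proof. exact/slice_frac_poly/slice_polyC. Qed.

Lemma slice_fracD f g : slice_frac f -> slice_frac g ->
  slice_frac (fun t => f t + g t).
Proof.
move=> [m pf] [n pg]; exists (m + n)%N.
rewrite (_ : (fun t => _) = fun t => sl_V t ^+ n * (sl_V t ^+ m * f t)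
    + sl_V t ^+ m * (sl_V t ^+ n * g t)); last first.
  by apply/funext => t; rewrite exprD; ring.
by apply: slice_polyD; apply: slice_polyM => //; apply: slice_polyX;
  exact: slice_polyV.
Qed.

Lemma slice_fracM f g : slice_frac f -> slice_frac g ->
  slice_frac (fun t => f t * g t).
Proof.
move=> [m pf] [n pg]; exists (m + n)%N.
rewrite (_ : (fun t => _) = fun t => (sl_V t ^+ m * f t) * (sl_V t ^+ n * g t)).
  exact: slice_polyM.
by apply/funext => t; rewrite exprD; ring.
Qed.

Lemma slice_fracN f : slice_frac f -> slice_frac (fun t => - f t).
Proof.
by move=> [k pf]; exists k; under eq_fun do rewrite mulrN; exact: slice_polyN.
Qed.

Lemma slice_fracX f n : slice_frac f -> slice_frac (fun t => f t ^+ n).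
Proof.
move=> pf; elim: n => [|n IH]; first exact: slice_fracC.
by under eq_fun do rewrite exprS; exact: slice_fracM.
Qed.

Lemma slice_frac_div f : slice_frac (fun t => sl_V t * f t) -> slice_frac f.
Proof.
by move=> [k pf]; exists k.+1; under eq_fun do rewrite exprSr -mulrA.
Qed.

Lemma slice_frac_sum (I : Type) (s : seq I) (P : pred I) (F : I -> slice -> K) :
  (forall i, P i -> slice_frac (F i)) -> slice_frac (fun t => \sum_(i <- s | P
    i) F i t).
Proof.
move=> pF; elim: s => [|i s IH].
  by under eq_fun do rewrite big_nil; exact: slice_fracC.
under eq_fun do rewrite big_cons.
case: (boolP (P i)) => [Pi|_] //.
by apply: slice_fracD => //; exact: pF.
Qed.

Lemma slice_frac_prod (I : Type) (s : seq I) (F : I -> slice -> K) :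
  (forall i, slice_frac (F i)) -> slice_frac (fun t => \prod_(i <- s) F i t).
Proof.
move=> pF; elim: s => [|i s IH].
  by under eq_fun do rewrite big_nil; exact: slice_fracC.
by under eq_fun do rewrite big_cons; exact: slice_fracM.
Qed.

Lemma slice_frac_a i : slice_frac (fun t => sl_a t 0 i).
Proof. exact/slice_frac_poly/slice_polya. Qed.

Lemma slice_frac_T i : (i < 9)%N ->
  slice_frac (fun t => pair_traces (diag_mx (sl_a t)) (sl_B t) i).
Proof.
move=> i9; have := slice_frac_poly (slice_polyT (Ordinal i9)).
exact.
Qed.

End SliceFunctions.

Ltac slice_frac_tac := repeat first
  [ exact: slice_fracC | exact: slice_frac_a | exact: slice_frac_T | assumption
  | apply: slice_fracD | apply: slice_fracN | apply: slice_fracM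
  | apply: slice_fracX ].

Section SliceGenerators.
Variable K : numClosedFieldType.
Local Notation slice := (slice K).

(** Cramer's rule: [sl_V t * g i t] is given by [lagrange3]. Cyclic permutations of the eigenvalues
    preserve [vdm3], so one formula serves all three entries. *)
Lemma slice_frac_lagrange (g : 'I_3 -> slice -> K) (n0 n1 n2 : nat) :
    let T n (t : slice) := pair_traces (diag_mx (sl_a t)) (sl_B t) n in
    let a (t : slice) := sl_a t 0 in
    (n0 < 9)%N -> (n1 < 9)%N -> (n2 < 9)%N ->
    (forall t, T n0 t = g 0 t + g 1 t + g 2 t) ->
    (forall t, T n1 t = a t 0 * g 0 t + a t 1 * g 1 t + a t 2 * g 2 t) ->
    (forall t, T n2 t = a t 1 * a t 2 * g 0 t + a t 0 * a t 2 * g 1 t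
      + a t 0 * a t 1 * g 2 t) ->
  forall i, slice_frac (g i).
Proof.
move=> T a l0 l1 l2 T0 T1 T2 i; apply: slice_frac_div.
have aE t : a t 0 * a t 1 * a t 2 = 1 by exact: sl_a1.
elim/ord3P: i.
- rewrite (_ : (fun t => _) = fun t : slice =>
    lagrange3 (a t 0) (a t 1) (a t 2) (T n0 t) (T n1 t) (T n2 t)).
    by rewrite /lagrange3 /T; slice_frac_tac.
  by apply/funext => t; rewrite T0 T1 T2 lagrange3P.
- rewrite (_ : (fun t => _) = fun t : slice =>
    lagrange3 (a t 1) (a t 2) (a t 0) (T n0 t) (T n1 t) (T n2 t)).
    by rewrite /lagrange3 /T; slice_frac_tac.
  apply/funext => t; rewrite T0 T1 T2 /sl_V -/(a t) /lagrange3 /vdm3.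
  by ring: (aE t).
- rewrite (_ : (fun t => _) = fun t : slice =>
    lagrange3 (a t 2) (a t 0) (a t 1) (T n0 t) (T n1 t) (T n2 t)).
    by rewrite /lagrange3 /T; slice_frac_tac.
  apply/funext => t; rewrite T0 T1 T2 /sl_V -/(a t) /lagrange3 /vdm3.
  by ring: (aE t).
Qed.

Lemma slice_frac_B i : slice_frac (fun t : slice => sl_B t i i).
Proof.
(* The traces of [B], [AB] and [A^-1 B]. *)
apply: (slice_frac_lagrange (g := fun i t => sl_B t i i)
  (n0 := 1) (n1 := 3) (n2 := 6)) => // t;
  by rewrite pair_traces_slice ?sl_a1 ?sl_B1.
Qed.

Lemma slice_frac_invB i : slice_frac (fun t : slice => invmx (sl_B t) i i).
Proof.
(* The traces of [B^-1], [A B^-1] and [A^-1 B^-1]. *)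
apply: (slice_frac_lagrange (g := fun i t => invmx (sl_B t) i i)
  (n0 := 2) (n1 := 5) (n2 := 4)) => // t;
  by rewrite pair_traces_slice ?sl_a1 ?sl_B1.
Qed.

End SliceGenerators.

Section SliceInvariants.
Variable K : numClosedFieldType.
Local Notation slice := (slice K).

(** As [det B = 1], the product [B_ij * B_ji] is [B_ii * B_jj] minus the remaining diagonal entry of
    [B^-1]. *)
Lemma slice_frac_pair i j : i != j ->
  slice_frac (fun t : slice => sl_B t i j * sl_B t j i).
Proof.
wlog: i j / (i < j)%N.
  move=> wij nij; have [ltij|ltji|/val_inj eij] := ltngtP i j; first exact: wij.
    by under eq_fun do rewrite mulrC; apply: wij; rewrite 1?eq_sym.
  by rewrite eij eqxx in nij.
have fB := @slice_frac_B K; have fC := @slice_frac_invB K.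
elim/ord3P: i; elim/ord3P: j => // _ _.
- rewrite (_ : (fun t => _) = fun t : slice =>
    sl_B t 0 0 * sl_B t 1 1 - invmx (sl_B t) 2 2).
    by slice_frac_tac.
  by apply/funext => t; have [_ _ ->] := slice_diag_inv (sl_B1 t); ring.
- rewrite (_ : (fun t => _) = fun t : slice =>
    sl_B t 0 0 * sl_B t 2 2 - invmx (sl_B t) 1 1).
    by slice_frac_tac.
  by apply/funext => t; have [_ -> _] := slice_diag_inv (sl_B1 t); ring.
- rewrite (_ : (fun t => _) = fun t : slice =>
    sl_B t 1 1 * sl_B t 2 2 - invmx (sl_B t) 0 0).
    by slice_frac_tac.
  by apply/funext => t; have [-> _ _] := slice_diag_inv (sl_B1 t); ring.
Qed.

(** The sum [al + be] and the commutator trace give two linear equations for the 3-cycle products,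
    of determinant [rho - rho' = sl_V] up to sign. *)
Lemma slice_frac_cycle :
  slice_frac (fun t : slice => sl_B t 0 1 * sl_B t 1 2 * sl_B t 2 0).
Proof.
have fB := @slice_frac_B K; have fC := @slice_frac_invB K.
apply: slice_frac_div.
rewrite (_ : (fun t => _) = fun t : slice =>
  pair_traces (diag_mx (sl_a t)) (sl_B t) 8
  - slice_C (sl_a t 0 0) (sl_a t 0 1) (sl_a t 0 2)
      (sl_B t 0 0) (sl_B t 1 1) (sl_B t 2 2)
      (invmx (sl_B t) 0 0) (invmx (sl_B t) 1 1) (invmx (sl_B t) 2 2)
  - slice_s (sl_B t 0 0) (sl_B t 1 1) (sl_B t 2 2)
      (invmx (sl_B t) 0 0) (invmx (sl_B t) 1 1) (invmx (sl_B t) 2 2)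
    * slice_rho' (sl_a t 0 0) (sl_a t 0 1) (sl_a t 0 2)).
  by rewrite /slice_C /slice_s /slice_rho'; slice_frac_tac.
apply/funext => t; rewrite pair_traces_slice8 ?sl_a1 ?sl_B1 //.
by rewrite -slice_cycle_sum ?sl_B1 // /sl_V -slice_rhoB; ring.
Qed.

Lemma slice_frac_cycle' :
  slice_frac (fun t : slice => sl_B t 0 2 * sl_B t 1 0 * sl_B t 2 1).
Proof.
have fB := @slice_frac_B K; have fC := @slice_frac_invB K.
have fcyc := slice_frac_cycle.
rewrite (_ : (fun t => _) = fun t : slice =>
  slice_s (sl_B t 0 0) (sl_B t 1 1) (sl_B t 2 2)
    (invmx (sl_B t) 0 0) (invmx (sl_B t) 1 1) (invmx (sl_B t) 2 2)
  - sl_B t 0 1 * sl_B t 1 2 * sl_B t 2 0); last first.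
  by apply/funext => t; rewrite -slice_cycle_sum ?sl_B1 //; ring.
apply: slice_fracD; last exact: slice_fracN.
by rewrite /slice_s; slice_frac_tac.
Qed.

Definition unit_weight (r i : 'I_3) : nat := i == r.

(** Read the exponents as a directed multigraph on three vertices: balance means equal in- and
    out-degrees, so its edges other than loops split into 2-cycles and 3-cycles. The excess of
    [l.2 0 1] over [l.2 1 0] counts the 3-cycles, its sign giving their orientation. *)
Lemma balancedE (l : monomial3 K) :
  balanced (unit_weight 1) l -> balanced (unit_weight 2) l ->
  exists (n01 n02 n12 : nat) (k : nat * nat),
    [/\ l.2 0 1 = (n01 + k.1)%N, l.2 1 2 = (n12 + k.1)%N, l.2 2 0 = (n02 +
      k.1)%N,
        l.2 0 2 = (n02 + k.2)%N & l.2 1 0 = (n01 + k.2)%N /\ l.2 2 1 = (n12 +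
          k.2)%N].
Proof.
rewrite /balanced /unit_weight !big_ord3 /= => /eqP b1 /eqP b2.
have [le|/ltnW le] := leqP (l.2 1 0) (l.2 0 1).
  exists (l.2 1 0), (l.2 0 2), (l.2 2 1), (subn (l.2 0 1) (l.2 1 0), 0%N) => /=.
  by split; [lia|lia|lia|lia|split; lia].
exists (l.2 0 1), (l.2 2 0), (l.2 1 2), (0%N, subn (l.2 1 0) (l.2 0 1)) => /=.
by split; [lia|lia|lia|lia|split; lia].
Qed.

Lemma slice_frac_mon (l : monomial3 K) :
    balanced (unit_weight 1) l -> balanced (unit_weight 2) l ->
  slice_frac (fun t : slice => eval_mon l (sl_a t) (sl_B t)).
Proof.
move=> b1 b2; have [n01 [n02 [n12 [k [e01 e12 e20 e02 [e10 e21]]]]]] :=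
  balancedE b1 b2.
rewrite (_ : (fun t => _) = fun t : slice =>
  l.1.1 * (\prod_i sl_a t 0 i ^+ l.1.2 i) * (\prod_i sl_B t i i ^+ l.2 i i)
  * ((sl_B t 0 1 * sl_B t 1 0) ^+ n01 * (sl_B t 0 2 * sl_B t 2 0) ^+ n02
    * (sl_B t 1 2 * sl_B t 2 1) ^+ n12)
  * ((sl_B t 0 1 * sl_B t 1 2 * sl_B t 2 0) ^+ k.1
    * (sl_B t 0 2 * sl_B t 1 0 * sl_B t 2 1) ^+ k.2)); last first.
  apply/funext => t; rewrite /eval_mon !big_ord3 /= e01 e12 e20 e02 e10 e21.
  by rewrite !exprMn !exprD; ring.
repeat first [exact: slice_fracC | exact: slice_frac_pair
  | exact: slice_frac_cycle | exact: slice_frac_cycle'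
  | apply: slice_fracM | apply: slice_fracX].
- by apply: slice_frac_prod => i; apply: slice_fracX; exact: slice_frac_a.
- by apply: slice_frac_prod => i; apply: slice_fracX; exact: slice_frac_B.
Qed.

End SliceInvariants.

(** * From the slice to all pairs *)

Section LocalGenerators.
Variable K : numClosedFieldType.
Local Notation slice := (slice K).

Fact slice_diag_subproof (t : slice) : \det (diag_mx (sl_a t)) == 1.
Proof. by rewrite det_diag big_ord3 /= sl_a1. Qed.

Fact slice_det_subproof (t : slice) : \det (sl_B t) == 1.
Proof. by rewrite sl_B1. Qed.

Definition slice_pair (t : slice) : SL K 3 * SL K 3 :=
  (exist _ (diag_mx (sl_a t)) (slice_diag_subproof t) : SL K 3,
   exist _ (sl_B t) (slice_det_subproof t) : SL K 3).

Variable f : SL K 3 * SL K 3 -> K^o.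
Hypothesis f_reg : coordinate_ring f.
Hypothesis f_inv : forall g, SL_act g f = f.

(** Conjugation by [diag(z ^+ w i)] fixes the diagonal matrix and scales each monomial by a power of
    [z]; as [f] does not change, only weight zero survives. *)
Lemma torus_filter (w : 'I_3 -> nat) (s : seq (monomial3 K)) :
    (forall t, f (slice_pair t) = \sum_(l <- s) eval_mon l (sl_a t) (sl_B t)) ->
  forall t, f (slice_pair t) =
    \sum_(l <- s | balanced w l) eval_mon l (sl_a t) (sl_B t).
Proof.
move=> fs t; apply/esym.
apply: (laurent_const (c := fun l => eval_mon l (sl_a t) (sl_B t))) => z z0.
pose D : 'M[K]_3 := diag_mx (\row_i z ^+ w i).
have Du : D \in unitmx.
  by rewrite unitmxE det_diag unitfE; apply/prodf_neq0 => i _;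
    rewrite mxE expf_neq0.
have Dinv : invmx D = diag_mx (\row_i (z ^+ w i)^-1).
  suff e : D *m diag_mx (\row_i (z ^+ w i)^-1) = 1%:M.
    by rewrite -[LHS]mulmx1 -e mulKmx.
  apply/matrixP => i j; rewrite mul_diag_mx !mxE.
  by case: eqP => [->|_]; rewrite ?mulr0n ?mulr0 // !mulr1n mulfV ?expf_neq0.
pose B' : 'M[K]_3 := \matrix_(i, j) (sl_B t i j * (z ^+ w j / z ^+ w i)).
have BE : B' = invmx D *m sl_B t *m D.
  apply/matrixP => i j; rewrite Dinv mul_mx_diag mul_diag_mx !mxE; ring.
have aE : diag_mx (sl_a t) = invmx D *m diag_mx (sl_a t) *m D.
  by rewrite Dinv; apply/matrixP => i j; rewrite mul_mx_diag mul_diag_mx !mxE;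
    case: eqP => [->|_]; rewrite ?mulr0n ?mulr0 ?mul0r // !mulr1n mulrAC mulVf
      ?mul1r ?expf_neq0.
have detB' : \det B' = 1.
  rewrite BE !det_mulmx det_inv mulrAC mulVf ?mul1r ?sl_B1 //.
  by rewrite -unitfE -unitmxE.
have t'P : ((sl_a t, B').1 0 0 * (sl_a t, B').1 0 1 * (sl_a t, B').1 0 2 == 1)
    && (\det (sl_a t, B').2 == 1) by rewrite /= sl_a1 detB' !eqxx.
pose t' : slice := exist _ (sl_a t, B') t'P.
have <- : f (slice_pair t') = f (slice_pair t) 
  by exact: (SL_act_GL (x := slice_pair t) (y := slice_pair t') f_inv Du aE BE).
rewrite fs; apply: eq_bigr => l _; rewrite -eval_mon_conj //.
Qed.

Lemma slice_frac_invariant : slice_frac (fun t => f (slice_pair t)).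
Proof.
have [p fp] := f_reg; have [s sE] := poly_monomials p.
have fs t : f (slice_pair t) = \sum_(l <- s) eval_mon l (sl_a t) (sl_B t).
  by rewrite fp -sE.
have {}fs t : f (slice_pair t) =
    \sum_(l <- [seq l <- s | balanced (unit_weight 1) l]) eval_mon l (sl_a t)
      (sl_B t).
  by rewrite big_filter; exact: torus_filter fs t.
have {}fs t : f (slice_pair t) = \sum_(l <- s |
    balanced (unit_weight 1) l && balanced (unit_weight 2) l) eval_mon l (sl_a
      t) (sl_B t).
  by rewrite -big_filter_cond; exact: torus_filter fs t.
under eq_fun do rewrite fs.
by apply: slice_frac_sum => l /andP[b1 b2]; exact: slice_frac_mon.
Qed.

Definition diagonalizes (x : SL K 3 * SL K 3) (a : 'rV[K]_3) :=
  exists2 P, P \in unitmx & P *m \val x.1 = diag_mx a *m P.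

Lemma diagonalizes_perm x a (p : 'I_3 -> 'I_3) : injective p ->
  diagonalizes x a -> diagonalizes x (\row_i a 0 (p i)).
Proof.
move=> p_inj [P Pu PE]; exists (row_perm (perm p_inj) P).
  by rewrite row_permE unitmx_mul unitmx_perm.
rewrite [X in X *m _]row_permE -mulmxA PE -row_permE !mul_diag_mx.
by apply/matrixP => i j; rewrite !mxE permE.
Qed.

Lemma diagonalizes_slice x a : diagonalizes x a ->
    a 0 0 * a 0 1 * a 0 2 = 1 ->
  exists t : slice, [/\ sl_a t = a, f (slice_pair t) = f x & sl_T t = traces_of
    x].
Proof.
move=> [P Pu PE] a1; pose B := P *m \val x.2 *m invmx P.
have x1E : \val x.1 = invmx P *m diag_mx a *m P by rewrite -mulmxA -PE mulKmx.
have x2E : \val x.2 = invmx P *m B *m P.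
  by rewrite /B !mulmxA mulVmx // mul1mx mulmxKV.
have detB : \det B = 1.
  rewrite !det_mulmx det_inv mulrAC mulfV ?mul1r ?SL_det //.
  by rewrite -unitfE -unitmxE.
have tP : ((a, B).1 0 0 * (a, B).1 0 1 * (a, B).1 0 2 == 1) && (\det (a, B).2 ==
  1).
  by rewrite /= a1 detB !eqxx.
pose t : slice := exist _ (a, B) tP; exists t; split=> //.
  by rewrite (SL_act_GL (x := slice_pair t) (y := x) f_inv Pu x1E x2E).
apply/funext => i; rewrite /sl_T /traces_of /pair_point x1E x2E pair_traces_conj
  //.
  by rewrite unitmxE det_diag big_ord3 /= a1 unitr1.
by rewrite unitmxE detB unitr1.
Qed.

(* Newton's recursion for the power sums of a1, a2, a3 with a1 a2 a3 = 1. *)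
Fixpoint psum_poly n : {mpoly K[9]} :=
  match n with
  | 0 => 3
  | 1 => mvar K 8 7
  | 2 => mvar K 8 7 ^+ 2 - 2 * mvar K 8 0
  | ((n'.+1 as n1).+1 as n2).+1 =>
      mvar K 8 7 * psum_poly n2 - mvar K 8 0 * psum_poly n1 + psum_poly n'
  end.

Lemma psum_polyE n x (a1 a2 a3 : K) : a1 * a2 * a3 = 1 ->
    x (inord 7) = a1 + a2 + a3 ->
    x (inord 0) = a2 * a3 + a1 * a3 + a1 * a2 ->
  (psum_poly n).@[x] = a1 ^+ n + a2 ^+ n + a3 ^+ n.
Proof.
move=> a123 x7 x0.
suff: [/\ (psum_poly n).@[x] = a1 ^+ n + a2 ^+ n + a3 ^+ n,
    (psum_poly n.+1).@[x] = a1 ^+ n.+1 + a2 ^+ n.+1 + a3 ^+ n.+1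
  & (psum_poly n.+2).@[x] = a1 ^+ n.+2 + a2 ^+ n.+2 + a3 ^+ n.+2] by case.
elim: n => [|n [IH0 IH1 IH2]].
  split; rewrite /= ?mevalB ?mevalM ?(rmorphXn (meval x)) ?(rmorph_nat (meval
    x)) /=
    ?meval_mvar ?x7 ?x0 ?expr0 ?expr1; ring.
split=> //; rewrite [psum_poly n.+3]/= mevalD mevalB !mevalM !meval_mvar x7 x0.
rewrite [X in _ * X - _]IH2 [X in _ - _ * X]IH1 IH0 !exprS; ring: a123.
Qed.

(** The sum of [a1 ^+ i * a2 ^+ j * a3 ^+ k] over the six orderings of the [a]'s, obtained from
    power sums by inclusion-exclusion on coinciding indices. *)
Definition sym_poly (i j k : nat) : {mpoly K[9]} :=
  psum_poly i * psum_poly j * psum_poly k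
  - psum_poly (i + j) * psum_poly k - psum_poly (i + k) * psum_poly j
  - psum_poly (j + k) * psum_poly i + 2 * psum_poly (i + j + k).

Lemma sym_polyE i j k x (a1 a2 a3 : K) : a1 * a2 * a3 = 1 ->
    x (inord 7) = a1 + a2 + a3 ->
    x (inord 0) = a2 * a3 + a1 * a3 + a1 * a2 ->
  (sym_poly i j k).@[x] =
    a1 ^+ i * a2 ^+ j * a3 ^+ k + a2 ^+ i * a3 ^+ j * a1 ^+ k
    + a3 ^+ i * a1 ^+ j * a2 ^+ k + a2 ^+ i * a1 ^+ j * a3 ^+ k
    + a1 ^+ i * a3 ^+ j * a2 ^+ k + a3 ^+ i * a2 ^+ j * a1 ^+ k.
Proof.
move=> a123 x7 x0; rewrite /sym_poly mevalD !mevalB !mevalM (rmorph_nat (meval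
  x)).
by rewrite !(psum_polyE _ a123 x7 x0) !exprD; ring.
Qed.

Lemma invariant_diagonalized : exists k (s : seq (term3 K)), forall x a,
    diagonalizes x a -> a 0 0 * a 0 1 * a 0 2 = 1 ->
  generic_disc x ^+ k * f x =
    \sum_(l <- s) eval_term l (traces_of x) (a 0 0) (a 0 1) (a 0 2).
Proof.
have [k fk] := slice_frac_invariant.
(* The extra factor [sl_V ^+ k] turns the denominator into a power of the discriminant, which is
   independent of the ordering of the eigenvalues. *)
have [s sE] := slice_polyM (slice_polyX k (slice_polyV K)) fk.
exists k, s => x a xa a1; have [t [ta tf tT]] := diagonalizes_slice xa a1.
rewrite -tf -tT -ta -sE mulrA -exprMn -expr2 vdm3_sqr ?ta //.
congr (_ ^+ _ * _); rewrite /generic_disc.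
have tT' i : (i < 9)%N -> pair_traces (\val x.1) (\val x.2) i =
    pair_traces (diag_mx (sl_a t)) (sl_B t) i.
  by move=> i9; have := congr1 (@^~ (Ordinal i9)) tT.
by rewrite [\tr (\val x.1)](tT' 7) // [\tr (invmx _)](tT' 0) //
  !pair_traces_slice
  ?sl_a1 ?sl_B1 // ta.
Qed.

(** Average over the six orderings of the eigenvalues: the left side does not depend on them, and
    the symmetrized monomials are polynomials in the traces of [A] and [A^-1]. *)
Lemma invariant_generic : exists k (H : {mpoly K[9]}), forall x,
  generic_disc x ^+ k * f x = H.@[traces_of x].
Proof.
have [k [s sE]] := invariant_diagonalized.
pose H := \sum_(l <- s) 6^-1 *: (l.1 * sym_poly l.2.1.1 l.2.1.2 l.2.2).
(* One more factor of the discriminant makes the identity trivial where [A] may fail to be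
   diagonalizable. *)
exists k.+1, (disc3 (mvar K 8 7) (mvar K 8 0) * H) => x.
rewrite mevalM -generic_discE exprS -mulrA.
have [->|gx] := eqVneq (generic_disc x) 0; first by rewrite !mul0r.
congr (_ * _).
have [P [a [Pu xE a1 V0]]] := diagonalize3 (SL_det x.1) gx.
have xa : diagonalizes x a by exists P => //; rewrite xE -!mulmxA mulKVmx.
have [t [ta _ tT]] := diagonalizes_slice xa a1.
have tT' i : (i < 8)%N -> traces_of x (inord i) = slice_traces
    (a 0 0) (a 0 1) (a 0 2) (sl_B t 0 0) (sl_B t 1 1) (sl_B t 2 2)
    (invmx (sl_B t) 0 0) (invmx (sl_B t) 1 1) (invmx (sl_B t) 2 2) i.
  move=> i8; rewrite -tT /sl_T /pair_point inordK ?(leqW i8) //.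
  by rewrite pair_traces_slice ?sl_a1 ?sl_B1 // ta.
have six i j l : uniq [:: i; j; l] -> generic_disc x ^+ k * f x =
    \sum_(m <- s) eval_term m (traces_of x) (a 0 i) (a 0 j) (a 0 l).
  move=> ijl; pose p (q : 'I_3) := nth 0 [:: i; j; l] q.
  have p_inj : injective p.
    by move=> q q' /eqP; rewrite /p nth_uniq // => /eqP /val_inj.
  rewrite (sE x (\row_q a 0 (p q))); first by rewrite !mxE.
    exact: diagonalizes_perm.
  rewrite !mxE -a1; have := big_ord3 *%R (fun q => a 0 (p q)).
  rewrite /= => <-; have := big_ord3 *%R (fun q => a 0 q); rewrite /= => <-.
  by rewrite [RHS](reindex_inj p_inj).
have x7 := tT' 7 isT; have x0 := tT' 0 isT; rewrite /slice_traces /= in x7 x0.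
rewrite raddf_sum /=; apply: (mulfI (_ : 6 != 0)); first by rewrite pnatr_eq0.
have -> : 6 * (generic_disc x ^+ k * f x) =
  generic_disc x ^+ k * f x + generic_disc x ^+ k * f x
  + generic_disc x ^+ k * f x + generic_disc x ^+ k * f x
  + generic_disc x ^+ k * f x + generic_disc x ^+ k * f x by ring.
rewrite {1}(six 0 1 2) // {1}(six 1 2 0) // {1}(six 2 0 1) // {1}(six 1 0 2) //.
rewrite {1}(six 0 2 1) // (six 2 1 0) // -!big_split mulr_sumr /=.
apply: eq_bigr => l _; rewrite mevalZ mevalM (sym_polyE _ _ _ a1 x7 x0).
by rewrite /eval_term; field.
Qed.

End LocalGenerators.

(** * Cancelling the denominators *)

(** The remainder of [h] modulo [d], multiplied by the constant [c], is still a multiple of [d]; its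
    degree is too small unless it is zero. *)
Lemma dvd_of_const_mul (S : idomainType) (c : S) (d h h' : {poly S}) :
    c != 0 -> lead_coef d \is a GRing.unit -> c%:P * h = d * h' ->
  exists g, h = d * g.
Proof.
move=> c0 ud e; have d0 : d != 0.
  by rewrite -lead_coef_eq0; apply: contraTneq ud => ->; rewrite unitr0.
have hE := Pdiv.IdomainUnit.divp_eq ud h.
suff r0 : h %% d = 0 by exists (h %/ d); rewrite mulrC {1}hE r0 addr0.
have {}e : c%:P * (h %% d) = d * (h' - c%:P * (h %/ d)).
  by rewrite mulrBr -e {2}hE; ring.
apply/eqP; apply: contraTT isT => r0.
have q0 : h' - c%:P * (h %/ d) != 0.
  apply: contraNneq r0 => q0; move: e; rewrite q0 mulr0 => /eqP.
  by rewrite mulf_eq0 polyC_eq0 (negPf c0).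
have : (size d <= size (c%:P * (h %% d))%R)%N.
  rewrite e size_mul //; move: q0; rewrite -size_poly_gt0.
  by case: (size _) => // n _; rewrite addnS leq_addr.
by rewrite mul_polyC size_scale // leqNgt ltn_modp d0.
Qed.

Section Gluing.
Variable K : numClosedFieldType.

Definition disc_fst : {mpoly K[8]} := disc3 (mvar K 7 7) (mvar K 7 0).
Definition disc_snd : {mpoly K[8]} := disc3 (mvar K 7 1) (mvar K 7 2).

Lemma muni_disc3 i j : muni (disc3 (mvar K 7 i) (mvar K 7 j)) =
  disc3 (muni (mvar K 7 i)) (muni (mvar K 7 j)).
Proof.
rewrite /disc3; set x := mvar K 7 i; set y := mvar K 7 j.
have muniX2 z : muni (z ^+ 2) = muni z ^+ 2 by rewrite expr2 muniM.
have muniX3 z : muni (z ^+ 3) = muni z ^+ 3 by rewrite exprS muniM muniX2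
  -exprS.
have muni_nat n : muni n%:R = n%:R by rewrite muniMn muni1.
rewrite !muniB muniD !muniB (muniM (x ^+ 2)) (muniM _ (x ^+ 3)) (muniM _ (y ^+
  3)).
by rewrite !muniX2 !muniX3 (muniM _ y) (muniM _ x) !muni_nat.
Qed.

Lemma muni_disc_fst :
  muni disc_fst = disc3 'X (mvar K 6 0)%:P.
Proof.
have X7 : mvar K 7 7 = 'X_ord_max.
  by congr 'X_[U_(_)]; apply/val_inj; rewrite /= inordK.
rewrite /disc_fst muni_disc3 (@muni_mvar K 6 0) //.
by rewrite X7 muniX_max.
Qed.

Lemma muni_disc_snd :
  muni disc_snd = (disc3 (mvar K 6 1) (mvar K 6 2))%:P.
Proof.
rewrite /disc_snd muni_disc3 (@muni_mvar K 6 1) // (@muni_mvar K 6 2) //.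
by rewrite (rmorph_disc3 polyC).
Qed.

(** In the trace of [A] the discriminant is a cubic with leading coefficient -4. *)
Lemma lead_disc_fst : lead_coef (muni disc_fst) \is a GRing.unit.
Proof.
rewrite muni_disc_fst; set c := mvar K 6 0.
pose q : {poly {mpoly K[7]}} := (c ^+ 2) *: 'X^2 + (18 * c) *: 'X - (4 * c ^+ 3
  + 27)%:P.
have -> : disc3 'X c%:P = (- 4%:MP) *: 'X^3 + q.
  rewrite /q /disc3 -!mul_polyC.
  have -> : (- 4%:MP)%:P = - 4%:R :> {poly {mpoly K[7]}}.
    by rewrite polyCN rmorph_nat rmorph_nat.
  rewrite polyCD !polyCM !(rmorph_nat polyC) -polyC_exp.
  by ring.
have n4 : (- 4%:MP : {mpoly K[7]}) != 0.
  by rewrite oppr_eq0 mpolyC_eq0 pnatr_eq0.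
rewrite lead_coefDl; last first.
  rewrite size_scale // size_polyXn ltnS /q.
  rewrite (leq_trans (size_polyD _ _)) // geq_max size_polyN.
  rewrite (leq_trans (size_polyC_leq1 _)) // andbT.
  rewrite (leq_trans (size_polyD _ _)) // geq_max.
  by rewrite !(leq_trans (size_scale_leq _ _)) ?size_polyX ?size_polyXn.
rewrite lead_coefZ lead_coefXn mulr1 unitrN.
by apply: rmorph_unit; rewrite unitfE pnatr_eq0.
Qed.

Lemma disc3_mvar_neq0 n i j : disc3 (mvar K n i) (mvar K n j) != 0.
Proof.
apply: contraTneq isT => /(congr1 (meval (fun=> 0))).
rewrite meval0 (rmorph_disc3 (meval _)) /= !meval_mvar.
have -> : disc3 0 0 = - 27%:R :> K by rewrite /disc3; ring.
by move/eqP; rewrite oppr_eq0 pnatr_eq0.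
Qed.

(* disc_fst is monic in the last variable up to a unit, while disc_snd does not
   involve that variable. *)
Lemma disc_coprime k (h h' : {mpoly K[8]}) :
  disc_snd ^+ k * h = disc_fst ^+ k * h' -> exists g, h = disc_fst ^+ k * g.
Proof.
move=> /(congr1 (@muni 7 K));
  rewrite !rmorphM !rmorphXn /= muni_disc_snd -rmorphXn /=.
case/dvd_of_const_mul.
- by rewrite expf_neq0 // disc3_mvar_neq0.
- by rewrite lead_coef_exp unitrX // lead_disc_fst.
move=> g hE; exists (of_muni g); rewrite -(muniK h) hE of_muniM; congr (_ * _).
by rewrite -rmorphXn /= muniK.
Qed.

End Gluing.

(** * Generators and relations of the invariants *)

Section Generators.
Variable K : numClosedFieldType.
Local Notation pairs := (SL K 3 * SL K 3)%type.

Fact det_tr_subproof (x : SL K 3) : \det (\val x)^T == 1.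
Proof. by rewrite det_tr SL_det. Qed.

Definition SL_tr (x : SL K 3) : SL K 3 := exist _ (\val x)^T (det_tr_subproof
  x).

(* This involution exchanges the two matrices but, unlike the plain swap,
   preserves the trace of the commutator. *)
Definition flip (x : pairs) : pairs := (SL_tr x.2, SL_tr x.1).

Lemma flipK : involutive flip.
Proof. by move=> [A B]; congr (_, _); apply/val_inj; rewrite /= trmxK. Qed.

Lemma regular_flip (f : pairs -> K^o) :
  coordinate_ring f -> coordinate_ring (fun x => f (flip x)).
Proof.
move=> [p fp]; under eq_fun do rewrite fp.
apply: regular_meval => k.
case: (split_ordP k) => {}k ->; case/mxvec_indexP: k => i j;
  rewrite /pair_coords.
  under eq_fun do rewrite row_mxEl mxvecE mxE; exact: regular_snd.
under eq_fun do rewrite row_mxEr mxvecE mxE; exact: regular_fst.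
Qed.

Lemma invariant_flip (f : pairs -> K^o) : (forall g, SL_act g f = f) ->
  forall g, SL_act g (fun x => f (flip x)) = (fun x => f (flip x)).
Proof.
move=> finv g; apply/funext => x; rewrite /SL_act.
have gu : invmx (\val g)^T \in unitmx by rewrite unitmx_inv unitmx_tr SL_unitmx.
by apply: (SL_act_GL (x := flip x)) finv gu _ _;
  rewrite /= invmxK !trmx_mul trmx_inv mulmxA.
Qed.

(** The permutation of the traces induced by [flip]: [A] and [B^T], up to transposition, trade
    places, and so do their inverses; [A B^-1] and [A^-1 B] are exchanged, and the other three
    traces are fixed. *)
Definition flip_traces : 9.-tuple {mpoly K[9]} :=
  [tuple mvar K 8 2; mvar K 8 7; mvar K 8 0; mvar K 8 3; mvar K 8 4;
         mvar K 8 6; mvar K 8 5; mvar K 8 1; mvar K 8 8].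

Lemma traces_of_flip x : traces_of (flip x) =
  fun i => (tnth flip_traces i).@[traces_of x].
Proof.
apply/funext => -[i i9]; rewrite /flip /traces_of /pair_point /pair_traces /=.
rewrite -!trmx_inv -!trmx_mul !mxtrace_tr (tnth_nth 0) /=.
do 8?[case: i i9 => [|i] i9 /=; first by rewrite meval_mvar inordK].
case: i i9 => [|i] i9 //=; rewrite meval_mvar inordK //=.
exact: mxtrace_mulC.
Qed.

Lemma invariant_generic_snd (f : pairs -> K^o) :
    coordinate_ring f -> (forall g, SL_act g f = f) ->
  exists k (H : {mpoly K[9]}), forall x,
    generic_disc (flip x) ^+ k * f x = H.@[traces_of x].
Proof.
move=> freg finv.
have [k [H HE]] := invariant_generic (regular_flip freg) (invariant_flip finv).
exists k, (H \mPo flip_traces) => x.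
by rewrite comp_mpoly_meval -traces_of_flip -HE flipK.
Qed.

Lemma meval_disc_fst x :
  (disc_fst K).@[traces_of x \o widen_ord (leqnSn 8)] = generic_disc x.
Proof.
rewrite generic_discE !(rmorph_disc3 (meval _)) /= !meval_mvar /=.
by congr disc3; congr traces_of; apply/val_inj; rewrite /= !inordK.
Qed.

Lemma meval_disc_snd x :
  (disc_snd K).@[traces_of x \o widen_ord (leqnSn 8)] = generic_disc (flip x).
Proof.
rewrite generic_discE traces_of_flip !(rmorph_disc3 (meval _)) /= !meval_mvar
  /=.
by congr disc3; rewrite (tnth_nth 0) /= inordK //= meval_mvar; congr traces_of;
  apply/val_inj; rewrite /= !inordK.
Qed.

Lemma traces_of_surj (y : 'I_9 -> K) : (rel_poly K).@[y] = 0 ->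
    (disc_fst K).@[y \o widen_ord (leqnSn 8)] != 0 ->
  exists x, traces_of x = y.
Proof.
rewrite meval_rel (rmorph_disc3 (meval _)) /= !meval_mvar /= => Fy dy.
have e i (i8 : (i < 8)%N) : widen_ord (leqnSn 8) (inord i) = inord i.
  by apply/val_inj; rewrite /= !inordK // leqW.
rewrite !e // in dy.
have e8 : inord 8 = ord_max :> 'I_9 by apply/val_inj; rewrite /= inordK.
have [|A [B [/eqP A1 /eqP B1 AB]]] := traces_surj (y := fun i => y (inord i))
  dy; first by rewrite e8.
exists (exist _ A A1 : SL K 3, exist _ B B1 : SL K 3); apply/funext => i.
by rewrite /traces_of /pair_point /= AB // inord_val.
Qed.

Lemma disc_fst_neq0 : disc_fst K != 0.
Proof. exact: disc3_mvar_neq0. Qed.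

(** The image of [traces_of] contains every zero of the relation with nonzero first discriminant,
    which is all that [rel_divides] asks for. *)
Lemma traces_kernel (p : {mpoly K[9]}) :
  (forall x, p.@[traces_of x] = 0) <-> exists q, p = q * rel_poly K.
Proof.
split=> [p0|[q ->] x]; last by rewrite mevalM rel_traces_of mulr0.
apply: (rel_divides disc_fst_neq0) => y Fy dy.
by have [x <-] := traces_of_surj Fy dy.
Qed.

Lemma traces_reduced_eq0 (r0 r1 : {mpoly K[8]}) :
  (forall x, (mwiden r0 + mwiden r1 * 'X_ord_max).@[traces_of x] = 0) ->
  r0 = 0 /\ r1 = 0.
Proof.
move=> r_0; apply: (rel_reduced_eq0 disc_fst_neq0) => y Fy dy.
by have [x <-] := traces_of_surj Fy dy.
Qed.

Theorem traces_generate (f : pairs -> K^o) :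
    coordinate_ring f -> (forall g, SL_act g f = f) ->
  exists p : {mpoly K[9]}, forall x, f x = p.@[traces_of x].
Proof.
move=> freg finv.
have [k1 [H1 H1E]] := invariant_generic freg finv.
have [k2 [H2 H2E]] := invariant_generic_snd freg finv.
pose k := (k1 + k2)%N.
(* Both identities are brought to the common exponent [k] and reduced to the basis formed by 1 and
   the last variable. *)
have [q [h0 [h1 hE]]] := rel_reduce (mwiden (disc_fst K) ^+ k2 * H1).
have [q' [g0 [g1 gE]]] := rel_reduce (mwiden (disc_snd K) ^+ k1 * H2).
have hT x : generic_disc x ^+ k * f x = h0.@[traces_of x \o widen_ord (leqnSn
  8)]
    + h1.@[traces_of x \o widen_ord (leqnSn 8)] * traces_of x ord_max.
  have := congr1 (meval (traces_of x)) hE.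
  rewrite mevalM -H1E mulrA rmorphXn /= meval_mwiden meval_disc_fst -exprD addnC
    => ->.
  rewrite mevalD mevalM rel_traces_of mulr0 add0r mevalD mevalM mevalXU.
  by rewrite !meval_mwiden.
have gT x : generic_disc (flip x) ^+ k * f x = g0.@[traces_of x \o widen_ord
  (leqnSn 8)]
    + g1.@[traces_of x \o widen_ord (leqnSn 8)] * traces_of x ord_max.
  have := congr1 (meval (traces_of x)) gE.
  rewrite mevalM -H2E mulrA rmorphXn /= meval_mwiden meval_disc_snd -exprD =>
    ->.
  rewrite mevalD mevalM rel_traces_of mulr0 add0r mevalD mevalM mevalXU.
  by rewrite !meval_mwiden.
(* Both expressions compute [f] times the [k]-th powers of both discriminants; coefficients in this
   basis are unique. *)
have [|/eqP + /eqP] := @traces_reduced_eq0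
    (disc_snd K ^+ k * h0 - disc_fst K ^+ k * g0)
    (disc_snd K ^+ k * h1 - disc_fst K ^+ k * g1).
  move=> x; rewrite mevalD mevalM mevalXU !meval_mwiden !mevalB !mevalM.
  rewrite !(rmorphXn (meval _)) /= meval_disc_fst meval_disc_snd.
  transitivity (generic_disc (flip x) ^+ k * (generic_disc x ^+ k * f x)
    - generic_disc x ^+ k * (generic_disc (flip x) ^+ k * f x)); last by ring.
  by rewrite hT gT; ring.
rewrite !subr_eq0 => /eqP /disc_coprime [e0 h0E] /eqP /disc_coprime [e1 h1E].
exists (mwiden e0 + mwiden e1 * 'X_ord_max) => x.
(* After cancellation the formula holds where the first discriminant is nonzero; density extends it
   to all pairs. *)
apply/eqP; rewrite -subr_eq0; apply/eqP; move: x; apply: regular_eq0_generic.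
  apply: regularB => //; apply: regular_meval; exact: regular_traces.
move=> x gx; apply: (mulfI (expf_neq0 k gx)).
rewrite mulr0 mulrBr hT mevalD mevalM mevalXU !meval_mwiden h0E h1E !mevalM.
by rewrite !(rmorphXn (meval _)) /= meval_disc_fst; ring.
Qed.

End Generators.

(** * Residue fields *)

Section Uncountable.
Variable R : realType.

(** Cantor's nested intervals: [[l n, l n + w n]] is cut in three, and the next interval is an outer
    third that avoids [f n]. *)
Lemma real_not_enumerable (f : nat -> R) : exists x, forall n, f n != x.
Proof.
pose w n : R := 3^-1 ^+ n.
pose step l n : R := if f n < l + w n / 2 then l + 2 * w n.+1 else l.
pose l := fix l n := if n is n'.+1 then step (l n') n' else 0.
have w_gt0 n : 0 < w n by rewrite exprn_gt0 ?invr_gt0 ?ltr0n.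
have wS n : w n = 3 * w n.+1 by rewrite /w exprS mulrA mulfV ?mul1r ?pnatr_eq0.
have l_le n : l n <= l n.+1.
  rewrite /= /step; case: ifP => // _; rewrite lerDl.
  by rewrite mulr_ge0 // ltW.
have lw_le n : l n.+1 + w n.+1 <= l n + w n.
  rewrite [l n.+1]/= /step (wS n); have := w_gt0 n.+1; case: ifP => _; lra.
have l_mono m n : (m <= n)%N -> l m <= l n.
  by move/subnK <-; elim: (n - m)%N => // k IH; rewrite (le_trans IH) ?addSn.
have lw_mono m n : (m <= n)%N -> l n + w n <= l m + w m.
  move/subnK <-; elim: (n - m)%N => // k; rewrite addSn; exact/le_trans/lw_le.
have l_bound m n : l m <= l n + w n.
  have [mn|/ltnW nm] := leqP m n.
    by rewrite (le_trans (l_mono _ _ mn)) // lerDl ltW.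
  by rewrite (le_trans _ (lw_mono _ _ nm)) // lerDl ltW.
exists (sup (range l)) => n; apply/eqP => fn.
have supP : has_sup (range l).
  split; first by exists (l 0%N), 0%N.
  by exists (l 0%N + w 0%N) => _ [m _ <-]; exact: l_bound.
have le_x m : l m <= sup (range l) by apply: sup_upper_bound => //; exists m.
have x_le m : sup (range l) <= l m + w m.
  by apply: ge_sup; [case: supP|move=> _ [k _ <-]; exact: l_bound].
have := le_x n.+1; have := x_le n.+1; rewrite -fn /= /step.
by have := w_gt0 n.+1; rewrite (wS n); case: ifP => [|/negbT]; rewrite -?leNgt;
  lra.
Qed.

(** If all fibres were finite, the reals could be enumerated by pairs of a fibre and a position in
    it. *)
Lemma infinite_fiber (g : R -> nat) : exists n, forall N, exists s : seq R,
  [/\ uniq s, size s = N & all (fun x => g x == n) s].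
Proof.
apply: contrapT => /forallNP fin.
have fin_fiber n : exists t : seq R, forall x, g x = n -> x \in t.
  have /existsNP[N nN] := fin n.
  elim: N nN => [|N IH] nN; first by case: nN; exists [::].
  have [[s [us sN sn]]|noN] := pselect (exists s : seq R,
      [/\ uniq s, size s = N & all (fun x => g x == n) s]); last exact: IH.
  exists s => x gx; apply: contraT => xs; case: nN; exists (x :: s).
  by rewrite /= xs us sN sn gx eqxx.
have [t tP] := choice fin_fiber.
pose f k : R := if unpickle k is Some ij then nth 0 (t ij.1) ij.2 else 0.
have [x fx] := real_not_enumerable f.
have /negP[] := fx (pickle (g x, index x (t (g x)))).
by rewrite /f pickleK /= nth_index // tP.
Qed.

End Uncountable.

Section MaximalIdeals.
Variables (K : closedFieldType) (A : comAlgType K) (m : {pred A}).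
Hypothesis m_max : maximal_ideal m.

Lemma maximal_idealr : idealr_closed m. Proof. by case: m_max. Qed.

Lemma max_ideal0 : 0 \in m. Proof. by case: maximal_idealr. Qed.

Lemma max_ideal1 : 1 \notin m. Proof. by case: maximal_idealr. Qed.

Lemma max_idealMl x y : y \in m -> x * y \in m.
Proof.
by move=> ym; case: maximal_idealr => m0 _ /(_ x y 0 ym m0); rewrite addr0.
Qed.

Lemma max_idealD x y : x \in m -> y \in m -> x + y \in m.
Proof. by move=> xm ym; case: maximal_idealr => _ _ /(_ 1 x y xm ym);
  rewrite mul1r. Qed.

Lemma max_idealN x : x \in m -> - x \in m.
Proof. by move=> xm; rewrite -mulN1r max_idealMl. Qed.

Lemma max_idealB x y : x \in m -> y \in m -> x - y \in m.
Proof. by move=> xm ym; rewrite max_idealD ?max_idealN. Qed.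

Lemma max_ideal_sum (I : Type) (s : seq I) (P : pred I) (F : I -> A) :
  (forall i, P i -> F i \in m) -> \sum_(i <- s | P i) F i \in m.
Proof.
move=> mF; elim/big_rec: _ => [|i x Pi xm]; first exact: max_ideal0.
by rewrite max_idealD ?mF.
Qed.

Lemma max_idealZ c x : x \in m -> c *: x \in m.
Proof. by move=> xm; rewrite -mulr_algl max_idealMl. Qed.

(** Otherwise the ideal generated by [m] and [x] is proper, hence contained in [m]. *)
Lemma max_ideal_inv x : x \notin m -> exists b, b * x - 1 \in m.
Proof.
move=> xm; apply: contrapT => nob.
pose I : {pred A} := fun y => `[< exists b, y - b * x \in m >].
have sub_mI : {subset m <= I}.
  by move=> y ym; apply/asboolP; exists 0; rewrite mul0r subr0.
have Iid : idealr_closed I.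
  split; first exact/sub_mI/max_ideal0.
    apply/negP => /asboolP[b b1]; apply: nob; exists b.
    by rewrite -opprB max_idealN.
  move=> u y z /asboolP[b yb] /asboolP[b' zb]; apply/asboolP.
  exists (u * b + b'); have -> : u * y + z - (u * b + b') * x =
      u * (y - b * x) + (z - b' * x) by ring.
  by rewrite max_idealD // max_idealMl.
have /(_ x) := m_max.2 I Iid sub_mI; rewrite (negPf xm) => /(_ _)/negP[] //.
by apply/asboolP; exists 1; rewrite mul1r subrr max_ideal0.
Qed.

Lemma max_ideal_prime x y : x \notin m -> y \notin m -> x * y \notin m.
Proof.
move=> /max_ideal_inv[b bx] /max_ideal_inv[c cy]; apply/negP => xy.
apply/negP: max_ideal1; rewrite negbK.
have -> : 1 = b * c * (x * y) - (b * x - 1) * (c * y) - (c * y - 1) by ring.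
apply: max_idealB => //; apply: max_idealB; first exact: max_idealMl.
by rewrite mulrC; exact: max_idealMl.
Qed.

(** Over an algebraically closed field [p] splits into linear factors; none of their values at [a]
    lies in [m], which is prime. *)
Lemma max_ideal_poly a (p : {poly K}) : (forall c, a - c%:A \notin m) -> p != 0
  ->
  horner_alg a p \notin m.
Proof.
move=> am p0; have [rs ->] := closed_field_poly_normal p.
rewrite -mul_polyC rmorphM /= horner_algC mulr_algl rmorph_prod /=.
have : \prod_(r <- rs) horner_alg a ('X - r%:P) \notin m.
  elim: rs => [|r rs IH]; first by rewrite big_nil max_ideal1.
  rewrite big_cons max_ideal_prime // rmorphB /= horner_algX horner_algC.
  exact: am.
apply: contra => /(max_idealZ (lead_coef p)^-1).
by rewrite scalerA mulVf ?scale1r // lead_coef_eq0.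
Qed.

End MaximalIdeals.

(* Otherwise every a - x with x real has an inverse modulo m.  Infinitely many
   of these inverses lie in one finite-dimensional space, and clearing
   denominators in a linear relation between them gives a nonzero polynomial
   in a lying in m. *)
Lemma residue_field_scalar (R : realType) (A : comAlgType R[i]) (N : nat -> nat)
  (e : nat -> nat -> A)
    (m : {pred A}) :
    (forall a, exists d (c : nat -> R[i]), a = \sum_(i < N d) c i *: e d i) ->
    maximal_ideal m ->
  forall a, exists c, a - c%:A \in m.
Proof.
move=> e_span m_max a; apply: contrapT => noc.
have am c : a - c%:A \notin m by apply/negP => ac; apply: noc; exists c.
have inv_x (x : R) : exists dc : nat * (nat -> R[i]),
    (\sum_(i < N dc.1) dc.2 i *: e dc.1 i) * (a - (real_complex R x)%:A) - 1 \in
      m.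
  have [b bP] := max_ideal_inv m_max (am (real_complex R x)).
  by have [d [c bE]] := e_span b; exists (d, c); rewrite -bE.
have [F FP] := choice inv_x.
(* One more inverse than the number of generators of the space, so that a linear relation [v]
   exists. *)
have [n /(_ (N n).+1)[s [us sn sF]]] := infinite_fiber (fun x => (F x).1).
pose x (j : 'I_(N n).+1) : R := nth 0 s j.
have x_inj : injective x.
  by move=> j k /eqP; rewrite /x nth_uniq ?sn // => /eqP /val_inj.
pose M : 'M_((N n).+1, N n) := \matrix_(j, i) (F (x j)).2 i.
have /rowV0Pn[v] : kermx M != 0.
  by rewrite -mxrank_eq0 mxrank_ker -lt0n subn_gt0 (leq_ltn_trans (rank_leq_col
    _)).
move=> /sub_kermxP vM v0.
pose b j : A := \sum_(i < N n) (F (x j)).2 i *: e n i.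
have bP j : b j * (a - (real_complex R (x j))%:A) - 1 \in m.
  have := FP (x j); have /allP/(_ (x j)) := sF.
  by rewrite mem_nth ?sn // => /(_ isT)/eqP dE; rewrite /b dE.
pose c j : R[i] := real_complex R (x j).
pose q j : {poly R[i]} := \prod_(k | k != j) ('X - (c k)%:P).
have bv : \sum_j v 0 j *: b j = 0.
  under eq_bigr do rewrite scaler_sumr.
  rewrite exchange_big big1 // => i _; under eq_bigr do rewrite scalerA.
  rewrite -scaler_suml; have /matrixP/(_ 0 i) := vM; rewrite !mxE => vMi.
  suff -> : \sum_j v 0 j * (F (x j)).2 i = 0 by rewrite scale0r.
  by rewrite -[RHS]vMi; apply: eq_bigr => j _; rewrite mxE.
pose p := \sum_j v 0 j *: q j.
(* At [c j] only the term [v 0 j *: q j] survives, and [q j] does not vanish there. *)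
have p0 : p != 0.
  have /rV0Pn[j vj] := v0; apply: contraNneq vj => pj.
  have : p.[c j] = 0 by rewrite pj horner0.
  rewrite horner_sum (bigD1 j) //= big1 => [|k kj].
    rewrite addr0 hornerZ => /eqP; rewrite mulf_eq0 => /orP[//|].
    rewrite horner_prod => /prodf_eq0[k kj]; rewrite hornerXsubC subr_eq0.
    by move=> /eqP /complexI /x_inj ejk; rewrite ejk eqxx in kj.
  rewrite hornerZ horner_prod (bigD1 j) 1?eq_sym //=.
  by rewrite hornerXsubC subrr mul0r mulr0.
(* Modulo [m], [horner_alg a (q j)] equals [b j * W], with [W] the product of all [a - c j]; so [p]
   at [a] becomes [W] times the vanishing combination of the [b j]. *)
have /negP[] := max_ideal_poly m_max am p0.
pose W := \prod_j (a - (c j)%:A).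
have WE j : W = (a - (c j)%:A) * horner_alg a (q j).
  rewrite /W (bigD1 j) //= rmorph_prod; congr (_ * _); apply: eq_bigr => k _.
  by rewrite rmorphB /= horner_algX horner_algC.
have pE : horner_alg a p = \sum_j v 0 j *: horner_alg a (q j).
  rewrite /p rmorph_sum /=; apply: eq_bigr => j _.
  by rewrite -mul_polyC rmorphM /= horner_algC mulr_algl.
have sumE : \sum_j v 0 j *: ((b j * (a - (c j)%:A) - 1) * horner_alg a (q j)) =
    - horner_alg a p.
  under eq_bigr do rewrite mulrBl mul1r scalerBr -mulrA -WE scalerAl.
  by rewrite sumrB -mulr_suml bv mul0r sub0r pE.
rewrite -[horner_alg a p]opprK -sumE; apply: max_idealN => //.
apply: max_ideal_sum => // j _; apply: max_idealZ => //.
by rewrite mulrC; apply: max_idealMl => //; exact: bP.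
Qed.

(** * The degree of the relation *)

Section Degree.
Variable K : numClosedFieldType.

(** [msize] is the total degree plus one, and 0 for the zero polynomial, which thus satisfies every
    bound. *)
Definition deg_le n d (p : {mpoly K[n]}) := (msize p <= d.+1)%N.

Lemma deg_leW n d e (p : {mpoly K[n]}) : deg_le d p -> (d <= e)%N -> deg_le e p.
Proof. by move=> pd de; rewrite /deg_le (leq_trans pd). Qed.

Lemma deg_leD n d (p q : {mpoly K[n]}) : deg_le d p -> deg_le d q -> deg_le d (p
  + q).
Proof.
by rewrite /deg_le => pd qd;
  rewrite (leq_trans (msizeD_le _ _)) // geq_max pd qd.
Qed.

Lemma deg_leN n d (p : {mpoly K[n]}) : deg_le d p -> deg_le d (- p).
Proof. by rewrite /deg_le msizeN. Qed.

Lemma deg_leM n d e (p q : {mpoly K[n]}) : deg_le d p -> deg_le e q ->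
  deg_le (d + e) (p * q).
Proof.
move=> pd qe; have [->|p0] := eqVneq p 0; first by rewrite mul0r /deg_le msize0.
have [->|q0] := eqVneq q 0; first by rewrite mulr0 /deg_le msize0.
rewrite /deg_le msizeM // in pd qe *.
by move: (msize p) (msize q) pd qe => a b; lia.
Qed.

Lemma deg_leX n d k (p : {mpoly K[n]}) : deg_le d p -> deg_le (k * d) (p ^+ k).
Proof.
move=> pd; elim: k => [|k IH]; first by rewrite expr0 /deg_le msize1.
by rewrite exprS mulSn; exact: deg_leM.
Qed.

Lemma deg_le_nat n k : deg_le 0 (k%:R : {mpoly K[n]}).
Proof. by rewrite /deg_le -(rmorph_nat (@mpolyC n K)) msizeC;
  case: (_ != 0). Qed.

Lemma deg_le_mvar n i : deg_le 1 (mvar K n i).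
Proof. by rewrite /deg_le msizeX mdeg1. Qed.

(** Restriction to a line through the origin does not raise the degree, so a suitable line bounds
    [msize] from below. *)
Lemma line_poly n (p : {mpoly K[n]}) (v : 'I_n -> K) : exists q : {poly K},
  (size q <= msize p)%N /\ forall z, p.@[fun i => v i * z] = q.[z].
Proof.
exists (\sum_(m <- msupp p) (p@_m * \prod_i v i ^+ m i) *: 'X^(mdeg m)); split.
  apply: (leq_trans (size_sum _ _ _)).
  apply/bigmax_leqP_seq => m mp _; apply: (leq_trans (size_scale_leq _ _)).
  by rewrite size_polyXn; exact: msize_mdeg_lt.
move=> z; rewrite mevalE horner_sum; apply: eq_bigr => m _.
rewrite hornerZ hornerXn -mulrA; congr (_ * _).
under eq_bigr do rewrite exprMn.
by rewrite big_split /= mdegE expr_sum.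
Qed.

Ltac deg_le_tac := repeat lazymatch goal with
  | |- is_true (deg_le _ (@GRing.add _ _ _)) => apply: deg_leD
  | |- is_true (deg_le _ (@GRing.opp _ _)) => apply: deg_leN
  end.

Ltac deg_le_mon := repeat lazymatch goal with
  | |- is_true (deg_le _ (@GRing.mul _ _ _)) => apply: deg_leM
  | |- is_true (deg_le _ (@GRing.exp _ _ _)) => apply: deg_leX
  | |- is_true (deg_le _ (@GRing.natmul _ _ _)) => exact: deg_le_nat
  | |- is_true (deg_le _ (mvar _ _ _)) => exact: deg_le_mvar
  end.

Lemma deg_rel_sum : deg_le 4 (rel_sum (mvar K 8)).
Proof.
by rewrite /rel_sum; deg_le_tac;
  (apply: deg_leW; [deg_le_mon|]).
Qed.

Lemma deg_rel_prod : deg_le 6 (rel_prod (mvar K 8)).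
Proof.
by rewrite /rel_prod; deg_le_tac;
  (apply: deg_leW; [deg_le_mon|]).
Qed.

Lemma rel_polyE : rel_poly K = 'X_ord_max ^+ 2
  - rel_sum (mvar K 8) * 'X_ord_max + rel_prod (mvar K 8).
Proof.
apply/eqP; rewrite -subr_eq0; apply/eqP/mpoly_eq0_meval => x.
rewrite mevalB meval_rel mevalD mevalB (rmorphXn (meval x)) mevalM /= !mevalXU.
rewrite (rmorph_rel_sum (meval x)) (rmorph_rel_prod (meval x)).
rewrite (eq_rel_sum (z := fun i => x (inord i))) => [|i _]; last first.
  by rewrite /= meval_mvar.
rewrite (eq_rel_prod (z := fun i => x (inord i))) => [|i _]; last first.
  by rewrite /= meval_mvar.
by rewrite subrr.
Qed.

Lemma deg_rel_poly : deg_le 6 (rel_poly K).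
Proof.
have deg1 : deg_le 1 ('X_ord_max : {mpoly K[9]}) by rewrite /deg_le msizeX
  mdeg1.
rewrite rel_polyE; apply: deg_leD; last exact: deg_rel_prod.
apply: deg_leD; first by apply: deg_leW (deg_leX 2 deg1) _.
by apply: deg_leN; apply: deg_leW (deg_leM deg_rel_sum deg1) _.
Qed.

(* On the line y0 = y1 = y2 = y7 = z, with the other coordinates zero, the
   relation has leading term 2 z^6. *)
Lemma msize_rel_poly : msize (rel_poly K) = 7.
Proof.
apply/eqP; rewrite eqn_leq [(_ <= 7)%N]deg_rel_poly /=.
pose v (i : 'I_9) : K := ((i : nat) \in [:: 0; 1; 2; 7])%:R.
have [q [sq qE]] := line_poly (rel_poly K) v; apply: leq_trans sq.
have -> : q = 2 *: 'X^6 + \poly_(i < 6) nth 0 [:: 9; 0; -12; 4; 1; -4] i.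
  apply/eqP; rewrite -subr_eq0; apply/eqP/poly_eq0_horner => z.
  rewrite hornerD hornerN hornerD hornerZ hornerXn horner_poly -qE meval_rel.
  rewrite /v /rel_sum /rel_prod /= !inordK //= !big_ord_recl big_ord0 /=.
  ring.
have n2 : (2 : K) != 0 by rewrite pnatr_eq0.
by rewrite size_polyDl size_scale ?size_polyXn // ltnS size_poly.
Qed.

End Degree.

(** * The quotient variety *)

Section Quotient.
Variable K : numClosedFieldType.
Local Notation A := (invariant_ring K 3).

Lemma trace_invariant (p : {mpoly K[9]}) :
  (fun x => p.@[traces_of x] : K^o) \in @is_invariant K 3.
Proof.
apply/asboolP; split; first by apply: regular_meval; exact: regular_traces.
by move=> g; apply/funext => x; rewrite /SL_act traces_of_conj.
Qed.

Definition trace_fun (p : {mpoly K[9]}) : A :=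
  exist _ (fun x => p.@[traces_of x] : K^o) (trace_invariant p).

Lemma trace_fun_surj (a : A) : exists p, a = trace_fun p.
Proof.
have /asboolP[areg ainv] := valP a.
have [p pE] := traces_generate areg ainv.
by exists p; apply/val_inj/funext.
Qed.

Lemma trace_funC c : trace_fun c%:MP = c%:A.
Proof. by apply/val_inj/funext => x; rewrite /= mevalC; exact/esym/mulr1. Qed.

Lemma trace_funD p q : trace_fun (p + q) = trace_fun p + trace_fun q.
Proof. by apply/val_inj/funext => x; rewrite /= mevalD. Qed.

Lemma trace_funN p : trace_fun (- p) = - trace_fun p.
Proof. by apply/val_inj/funext => x; rewrite /= mevalN. Qed.

Lemma trace_funB p q : trace_fun (p - q) = trace_fun p - trace_fun q.
Proof. by rewrite trace_funD trace_funN. Qed.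

Lemma trace_funM p q : trace_fun (p * q) = trace_fun p * trace_fun q.
Proof. by apply/val_inj/funext => x; rewrite /= mevalM. Qed.

Lemma trace_funZ c p : trace_fun (c *: p) = c *: trace_fun p.
Proof. by rewrite -mul_mpolyC trace_funM trace_funC mulr_algl. Qed.

Lemma trace_fun_sum (I : Type) (s : seq I) (P : pred I) F :
  trace_fun (\sum_(i <- s | P i) F i) = \sum_(i <- s | P i) trace_fun (F i).
Proof.
elim/big_rec2: _ => [|i y x _ <-]; last by rewrite trace_funD.
by rewrite -mpolyC0 trace_funC scale0r.
Qed.

Lemma trace_fun_eq0 p : trace_fun p = 0 <-> exists q, p = q * rel_poly K.
Proof.
rewrite -traces_kernel; split=> [p0 x|p0]; last exact/val_inj/funext.
by have /(congr1 (@^~ x)) := congr1 \val p0.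
Qed.

Lemma trace_fun_rel : trace_fun (rel_poly K) = 0.
Proof. by apply/trace_fun_eq0; exists 1; rewrite mul1r. Qed.

(** The invariants are exhausted by the spaces spanned by monomials of degree at most [d] in the
    traces: the countable filtration behind the computation of residue fields. *)
Lemma trace_fun_span : exists (N : nat -> nat) (e : nat -> nat -> A),
  forall a, exists d (c : nat -> K), a = \sum_(i < N d) c i *: e d i.
Proof.
pose mon d i : 'X_{1..9 < d.+1} := nth bm0 (enum {: 'X_{1..9 < d.+1}}) i.
exists (fun d => #|{: 'X_{1..9 < d.+1}}|), (fun d i => trace_fun 'X_[mon d i])
  => a.
have [p ->] := trace_fun_surj a;
  exists (msize p), (fun i => p@_(mon (msize p) i)).
rewrite {1}(mpolywE (leqnSn (msize p))) trace_fun_sum.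
under eq_bigr do rewrite trace_funZ.
rewrite -big_enum /= (big_nth bm0) big_mkord -cardE.
by [].
Qed.

Definition relation_locus : set ('I_9 -> K) :=
  [set x | (rel_poly K).@[x] = 0]%classic.

Section Residues.
Variable m : max_spectrum A.

Lemma max_spectrumP : maximal_ideal (sval m : {pred A}).
Proof. exact: (asboolW (svalP m)). Qed.

Lemma residue_unique (a : A) c c' : sval m (a - c%:A) -> sval m (a - c'%:A) -> c
  = c'.
Proof.
move=> ac ac'; apply/eqP; rewrite -subr_eq0; apply: contraT => cc'.
have mm := max_spectrumP; have /negP[] := max_ideal1 mm.
have -> : 1 = (c - c')^-1 *: ((a - c'%:A) - (a - c%:A)).
  by rewrite opprB [_ + (c%:A - a)]addrC addrA subrK -scalerBl scalerA mulVf
    ?scale1r.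
by apply: (max_idealZ mm); apply: (max_idealB mm).
Qed.

Lemma residue_trace_fun (y : 'I_9 -> K) p :
    (forall i, sval m (trace_fun 'X_i - (y i)%:A)) ->
  sval m (trace_fun p - (p.@[y])%:A).
Proof.
move=> yP; have mm := max_spectrumP.
elim/mpoly_generators_ind: p => [c|i|p q IHp IHq|p q IHp IHq].
- by rewrite trace_funC mevalC subrr; exact: (max_ideal0 mm).
- by rewrite mevalXU.
- rewrite trace_funD mevalD scalerDl opprD addrACA; exact: (max_idealD mm).
have -> : trace_fun (p * q) - ((p * q).@[y])%:A =
    trace_fun q * (trace_fun p - (p.@[y])%:A) + p.@[y] *: (trace_fun q -
      (q.@[y])%:A).
  by rewrite trace_funM mevalM scalerBr scalerA mulrBr mulr_algr [trace_fun q *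
    _]mulrC
    addrA subrK.
by apply: (max_idealD mm); [apply: (max_idealMl mm)|apply: (max_idealZ mm)].
Qed.

End Residues.

Lemma residue_eq0 (m : max_spectrum A) c : sval m (c%:A) -> c = 0.
Proof.
move=> mc; apply: (residue_unique (m := m) (a := 0)).
  by rewrite sub0r; apply: (max_idealN (max_spectrumP m)).
by rewrite scale0r subr0; exact: (max_ideal0 (max_spectrumP m)).
Qed.

Lemma relation_locus_residue (m : max_spectrum A) (y : 'I_9 -> K) :
  (forall i, sval m (trace_fun 'X_i - (y i)%:A)) -> relation_locus y.
Proof.
move=> /(residue_trace_fun (rel_poly K)); rewrite trace_fun_rel sub0r.
move=> /(max_idealN (max_spectrumP m)); rewrite opprK; exact: residue_eq0.
Qed.

(* The points of the hypersurface are the kernels of the evaluation maps. *)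
Definition point_ideal (y : 'I_9 -> K) (a : A) : bool :=
  `[< exists2 p, a = trace_fun p & p.@[y] = 0 >].

(** Properness holds because every relation vanishes at [y]. An element with nonzero value at [y]
    differs from a nonzero scalar by an element of the kernel, so a larger ideal contains a unit. *)
Lemma point_ideal_maximal (y : 'I_9 -> K) : relation_locus y ->
  maximal_ideal (point_ideal y).
Proof.
move=> Xy; split; first split.
- by apply/asboolP; exists 0; rewrite ?meval0 // -mpolyC0 trace_funC scale0r.
- apply/negP => /asboolP[p p1 py].
  have /trace_fun_eq0[q pq] : trace_fun (p - 1) = 0.
    by rewrite trace_funB -p1 -mpolyC1 trace_funC scale1r subrr.
  have /eqP := congr1 (meval y) pq; rewrite mevalM Xy mulr0 mevalB py meval1.
  by rewrite sub0r oppr_eq0 oner_eq0.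
- move=> a u v /asboolP[p -> py] /asboolP[q -> qy].
  have [r ->] := trace_fun_surj a; apply/asboolP; exists (r * p + q).
    by rewrite trace_funD trace_funM.
  by rewrite mevalD mevalM py qy mulr0 addr0.
move=> I Iid sub_I a aI; have [p aE] := trace_fun_surj a.
apply/asboolP; exists p => //; apply: contrapT => /eqP py.
have [I0 /negP nI1 Imul] := Iid; set c := p.@[y] in py.
have cI : c%:A \in I.
  have -> : c%:A = -1 * (a - c%:A) + a by rewrite mulN1r opprB subrK.
  apply: Imul => //; apply: sub_I; apply/asboolP; exists (p - c%:MP).
    by rewrite trace_funB trace_funC aE.
  by rewrite mevalB mevalC subrr.
apply: nI1; have -> : 1 = (c^-1)%:A * c%:A + 0 :> A.
  by rewrite addr0 mulr_algl scalerA mulVf ?scale1r.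
exact: Imul.
Qed.

Hypothesis residue_exists : forall (m : max_spectrum A) a, exists c, sval m (a -
  c%:A).

(** A maximal ideal goes to the residues of the nine traces; conversely a point [y] comes from
    [point_ideal y]. *)
Lemma quotient_isomorphic :
  isomorphic (conj_quotient K 3) (affine_subvariety relation_locus).
Proof.
have pt (m : max_spectrum A) : exists x : relation_locus,
    forall i, sval m (trace_fun 'X_i - (\val x i)%:A).
  have [y yP] := choice (fun i => residue_exists m (trace_fun 'X_i)).
  by exists (SigSub (mem_set (relation_locus_residue yP))).
have [phi phiP] := choice pt.
have key (m : max_spectrum A) p : sval m (trace_fun p - (p.@[\val (phi m)])%:A).
  by apply: residue_trace_fun; exact: phiP.
have mem_m (m : max_spectrum A) p : sval m (trace_fun p) <-> p.@[\val (phi m)] =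
  0.
  have mm := max_spectrumP m; split=> [mp|p0].
    apply: (residue_eq0 (m := m)); rewrite -[_%:A](subKr (trace_fun p)).
    by apply: (max_idealB mm) => //; exact: key.
  by have := key m p; rewrite p0 scale0r subr0.
have phi_inj : injective phi.
  move=> m m' mm'; apply/val_inj/funext => a; have [p ->] := trace_fun_surj a.
  by apply/idP/idP => /mem_m p0; apply/mem_m; rewrite ?mm' // -mm'.
have psi_ex (x : relation_locus) : exists m, phi m = x.
  have Xx : relation_locus (\val x) by exact: (set_mem (valP x)).
  pose m : max_spectrum A := 
    exist _ (point_ideal (\val x)) (asboolT (point_ideal_maximal Xx)).
  exists m; apply/val_inj/funext => i; apply: (residue_unique (m := m)).
    exact: phiP.
  apply/asboolP; exists ('X_i - (\val x i)%:MP).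
    by rewrite trace_funB trace_funC.
  by rewrite mevalB mevalXU mevalC subrr.
have [psi psiP] := choice psi_ex.
exists phi; split; first by exists psi => // m; apply: phi_inj.
move=> f; split.
  by move=> [p fp]; exists (trace_fun p) => m; rewrite /= fp; exact: key.
move=> [a aP]; have [p pE] := trace_fun_surj a; exists p => x.
rewrite -(psiP x); apply: (residue_unique (m := psi x) (a := a));
  first exact: aP.
by rewrite pE; exact: key.
Qed.

End Quotient.

(** * Projection onto affine space, and conclusion *)

Section Surjectivity.
Variable K : numClosedFieldType.

(** The relation is monic quadratic in the forgotten coordinate, so the quadratic formula gives a
    point over every [x]. *)
Lemma relation_locus_onto :
  (@forget_last K 8 @` relation_locus (K := K) = setT)%classic.
Proof.
apply/seteqP; split=> // x _.
pose S := rel_sum (fun i => x (inord i));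
  pose Q := rel_prod (fun i => x (inord i)).
pose y := (S + sqrtC (S ^+ 2 - 4 * Q)) / 2.
exists (rcons_ord x y); last by apply/funext => i;
  rewrite /forget_last rcons_ord_widen.
rewrite /relation_locus /= meval_muni muni_rel rel_uni_evalE rcons_ord_max.
have -> : rcons_ord x y \o widen_ord (leqnSn 8) = x.
  by apply/funext => j /=; rewrite rcons_ord_widen.
have rtE : sqrtC (S ^+ 2 - 4 * Q) ^+ 2 = S ^+ 2 - 4 * Q by rewrite sqrtCK.
rewrite -/S -/Q.
have -> : y ^+ 2 - S * y + Q =
    (sqrtC (S ^+ 2 - 4 * Q) ^+ 2 - (S ^+ 2 - 4 * Q)) / 4 by rewrite /y; field.
by rewrite rtE subrr mul0r.
Qed.

Lemma relation_locus_hypersurface : hypersurface_of_degree 6 (relation_locus (K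
  := K)).
Proof.
exists (rel_poly K); split=> //; first exact: msize_rel_poly.
move=> p; split=> [p0|[q ->] x Xx]; last by rewrite mevalM Xx mulr0.
by apply: (rel_divides (oner_neq0 _)) => x Xx _; exact: p0.
Qed.

End Surjectivity.

Local Open Scope classical_set_scope.

Theorem theorem8 (R : realType) :
  exists X : set ('I_9 -> R[i]),
    [/\ hypersurface_of_degree 6 X,
        isomorphic (conj_quotient R[i] 3) (affine_subvariety X)
      & (@forget_last R[i] 8) @` X = setT].
Proof.
exists (relation_locus (K := R[i])); split.
- exact: relation_locus_hypersurface.
(* Uncountability of the scalars enters here, through [residue_field_scalar]. *)
- apply: quotient_isomorphic => m; have [N [e eP]] := trace_fun_span R[i].
  exact: (residue_field_scalar eP (max_spectrumP m)).
- exact: relation_locus_onto.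
Qed.
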